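(* Let $m\ge 1$ be an integer, let $V_{(m)}=\mathbb C[a_{-m},a_{-m-1},\ldots]\cdot v_{1-m}$, and let $\phi^+_{\sqrt{2m}}(z)=a_{-m}+za_{-m-1}+z^2a_{-m-2}+\cdots$. Then $$V_{(m)}\simeq\mathbb C[a_{-m},a_{-m-1},\ldots]/\langle(\phi^+_{\sqrt{2m}}(z)^{(i)})^2\rangle_{0\le i\le m-1},$$ where $\phi^+_{\sqrt{2m}}(z)^{(i)}$ is the $i$-th derivative in $z$. That is, the ideal of relations in $V_{(m)}$ (the ideal of those polynomials $P$ in commuting variables $a_{-m},a_{-m-1},\ldots$ with $P\cdot v_{1-m}=0$) is generated by the coefficients of the series $(\phi^+_{\sqrt{2m}}(z)^{(i)})^2$, $0\le i\le m-1$, namely by $$\sum_{\substack{\alpha_1+\alpha_2=s\\ \alpha_1,\alpha_2\ge0}}a_{-m-\alpha_1}a_{-m-\alpha_2}\,\alpha_1(\alpha_1-1)\cdots(\alpha_1-i+1)\,\alpha_2(\alpha_2-1)\cdots(\alpha_2-i+1),\qquad s\ge0,\ i=0,\ldots,m-1.$$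
   Context: Fix an integer $m\ge 1$. Let $H$ be the Heisenberg Lie algebra with basis $h_i$, $i\in\mathbb Z$, $[h_i,h_j]=i\,\delta_{i+j,0}$ (the central element acts as $1$). For a scalar $\lambda$ let $H_\lambda$ be the highest weight (Fock) representation with highest weight vector $|\lambda\rangle$: $h_i|\lambda\rangle=0$ for $i>0$, $h_0|\lambda\rangle=\lambda|\lambda\rangle$, and $H_\lambda=\mathbb C[h_{-1},h_{-2},\ldots]|\lambda\rangle$ is free over $\mathbb C[h_{-1},h_{-2},\ldots]$. For $0\le i\le 2m-1$ put $L_{(m),i}=\bigoplus_{n\in\mathbb Z}H_{(2nm+i)/\sqrt{2m}}$. On $\bigoplus_i L_{(m),i}$ the bosonic vertex operator is $$\phi_{\sqrt{2m}}(z)=\exp\Big(\sqrt{2m}\sum_{n>0}\tfrac{h_{-n}}{n}z^n\Big)\exp\Big(-\sqrt{2m}\sum_{n>0}\tfrac{h_{n}}{n}z^{-n}\Big)\,T\,z^{\sqrt{2m}\,h_0}=\sum_{n\in\mathbb Z}a_nz^{-n-1},$$ where $T$ commutes with all $h_i$, $i\ne0$, and $T|\lambda\rangle=|\lambda+\sqrt{2m}\rangle$. The operators $a_n$ pairwise commute. Put $v_p=\left|\frac{-p}{\sqrt{2m}}\right\rangle$ for $p\in\mathbb Z$; then $a_iv_p=0$ for $i\ge p$. *)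

(* Defs.v *)
From HB Require Import structures.
From mathcomp Require Import all_boot all_order all_algebra.
From mathcomp Require Import finmap monalg.
From mathcomp Require Import complex reals.

Set Implicit Arguments.
Unset Strict Implicit.
Unset Printing Implicit Defensive.

Import Order.TTheory GRing.Theory Num.Theory.
Local Open Scope ring_scope.

(* A polynomial ring in countably many commuting variables x_0, x_1, ... *)
Notation polyN K := {malg K[{cmonom nat}]}.
Notation varN K k := (<< ucm (k%N : nat) >> : polyN K).

Section IdealGen.
Variables (A : comNzRingType) (I : Type).

Definition ideal_gen (g : I -> A) (P : A) : Prop :=
  exists s : seq (A * I), P = \sum_(t <- s) t.1 * g t.2.

End IdealGen.

(* Formal power series, as coefficient sequences. *)
Section Series.
Variables (K : fieldType) (A : comAlgType K).
Implicit Types f g : nat -> A.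

Definition fps_one : nat -> A := fun n => (n == 0%N)%:R.

Definition fps_mul f g : nat -> A :=
  fun n => \sum_(k < n.+1) f k * g (n - k)%N.

Definition fps_pow f (j : nat) : nat -> A := iter j (fps_mul f) fps_one.

Definition fps_deriv f : nat -> A := fun n => f n.+1 *+ n.+1.

(* Only for series f without constant term: then f^j has order at least j, so
   that j <= n covers all the contributions to the coefficient of z^n. *)
Definition fps_exp f : nat -> A :=
  fun n => \sum_(j < n.+1) (j`!%:R : K)^-1 *: fps_pow f j n.

(* coefficient of z^k for an integer k *)
Definition fps_coefz f (k : int) : A := if k is Posz n then f n else 0.

End Series.

(* P . v, where the variable x_k acts on the vector space E by op k.  The
   order in which the operators are composed only matters if they do not
   commute. *)
Section Action.
Variables (K : fieldType) (E : lmodType K) (op : nat -> E -> E).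

Definition monom_act (M : {cmonom nat}) (v : E) : E :=
  foldr (fun k => iter (M k) (op k)) v (enum_fset (finsupp M)).

Definition poly_act (P : polyN K) (v : E) : E :=
  \sum_(M <- msupp P) P@_M *: monom_act M v.

Definition cyclic_sub (v : E) (w : E) : Prop := exists P, w = poly_act P v.

(* V is isomorphic, as a module over the polynomial ring, to its quotient by
   the ideal I: there is a linear map which commutes with the action, has
   image V, and has kernel I. *)
Definition iso_quotient (V : E -> Prop) (I : polyN K -> Prop) : Prop :=
  exists f : {linear polyN K -> E},
    [/\ forall P Q, f (P * Q) = poly_act P (f Q),
        forall w, V w <-> exists P, f P = w
      & forall P, f P = 0 <-> I P].

End Action.

Section Fock.
Variables (K : numClosedFieldType) (m : nat).

Local Notation sq2m := (sqrtC (2 * m)%N%:R : K).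

(* The space \bigoplus_(0 <= i < 2m) L_{(m),i}, which is the direct sum of the
   H_{p / sqrt (2m)} over all integers p.  The basis vector << (p, M) >> is
     (\prod_k h_{-(k+1)} ^ (M k)) | p / sqrt (2m) >. *)
Definition fock := {malg K[(int * {cmonom nat})%type]}.

Definition fvec (p : int) (M : {cmonom nat}) : fock := << (p, M) >>.

Definition weight (p : int) : K := p%:~R / sq2m.

Lemma weightK p : (0 < m)%N -> sq2m * weight p = p%:~R.
Proof.
move=> m0; rewrite /weight mulrC divfK // sqrtC_eq0 pnatr_eq0.
by rewrite muln_eq0 -lt0n m0.
Qed.

Lemma weightD p : (0 < m)%N -> weight (p + (2 * m)%N%:Z) = weight p + sq2m.
Proof.
move=> m0; have nz : sq2m != 0.
  by rewrite sqrtC_eq0 pnatr_eq0 muln_eq0 -lt0n m0.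
apply: (mulfI nz); rewrite mulrDr (weightK _ m0) (weightK _ m0).
by rewrite mulrzDr -expr2 sqrtCK pmulrn.
Qed.

Definition lin_ext (f : int -> {cmonom nat} -> fock) (u : fock) : fock :=
  \sum_(b <- msupp u) u@_b *: f b.1 b.2.

Lemma lin_extEw f (d : {fset (int * {cmonom nat})%type}) (u : fock) :
  (msupp u `<=` d)%fset -> lin_ext f u = \sum_(b <- d) u@_b *: f b.1 b.2.
Proof.
move=> le; rewrite /lin_ext (big_fset_incl _ le) //= => b _ /mcoeff_outdom ->.
by rewrite scale0r.
Qed.

Lemma lin_ext_is_linear f : linear (lin_ext f).
Proof.
move=> c u v; pose d := (msupp u `|` msupp v `|` msupp (c *: u + v))%fset.
rewrite !(@lin_extEw f d) ?fsubsetUr //; last first.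
- by rewrite /d -fsetUA fsubsetUl.
- by apply: fsubset_trans (fsubsetUl _ _); rewrite fsubsetUr.
rewrite scaler_sumr -big_split /=; apply: eq_bigr => b _.
by rewrite mcoeffD mcoeffZ scalerDl scalerA.
Qed.

HB.instance Definition _ f :=
  GRing.isLinear.Build K fock fock *:%R (lin_ext f) (lin_ext_is_linear f).

Lemma lin_ext_fvec f p M : lin_ext f (fvec p M) = f p M.
Proof. by rewrite /lin_ext /fvec msuppU oner_eq0 big_seq_fset1 mcoeffUU scale1r. Qed.

(* h_{k+1} acts as (k + 1) d/dh_{-(k+1)} *)
Definition heis (i : int) : fock -> fock :=
  lin_ext (fun p M =>
    match i with
    | Posz 0 => weight p *: fvec p M
    | Posz k.+1 => (k.+1 * M k)%N%:R *: fvec p (divcm M (ucm k))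
    | Negz k => fvec p (mulcm M (ucm k))
    end).

HB.instance Definition _ i := GRing.Linear.copy (heis i) (lin_ext _).

Lemma fockE (u : fock) : u = \sum_(b <- msupp u) u@_b *: fvec b.1 b.2.
Proof.
rewrite {1}[u]monalgE; apply: eq_bigr => -[p M] _.
apply/malgP => b; rewrite [RHS]mcoeffZ [LHS]mcoeffU /fvec mcoeffU.
by case: eqP => _; rewrite ?mulr1 ?mulr0.
Qed.

Lemma heis_comm (i j : int) u :
  heis i (heis j u) - heis j (heis i u) = (i *+ (i + j == 0))%:~R *: u.
Proof.
have sC (a b : K) (v : fock) : a *: (b *: v) = b *: (a *: v).
  by rewrite !scalerA mulrC.
have [mu muE] : exists mu, forall k (N : {cmonom nat}),
  mulcm N (ucm k) = mu k N by eexists.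
have [dv dvE] : exists dv, forall k (N : {cmonom nat}),
  divcm N (ucm k) = dv k N by eexists.
have mu_ev k l N : mu k N l = (N l + (k == l))%N by rewrite -muE mulcmE ucmE.
have dv_ev k l N : dv k N l = (N l - (k == l))%N by rewrite -dvE divcmE ucmE.
have hS k (I : Type) (r : seq I) (F : I -> fock) :
    heis k (\sum_(b <- r) F b) = \sum_(b <- r) heis k (F b).
  exact: raddf_sum.
have hZ k (c : K) (v : fock) : heis k (c *: v) = c *: heis k v.
  exact: linearZ.
have hpos k q N : heis (Posz k.+1) (fvec q N)
    = (k.+1 * N k)%N%:R *: fvec q (dv k N).
  by rewrite /heis lin_ext_fvec dvE.
have h0 q N : heis (Posz 0) (fvec q N) = weight q *: fvec q N.
  by rewrite /heis lin_ext_fvec.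
have hneg k q N : heis (Negz k) (fvec q N) = fvec q (mu k N).
  by rewrite /heis lin_ext_fvec muE.
have uE := fockE u.
move: heis fvec (weight) hS hZ hpos h0 hneg uE => h V w hS hZ hpos h0 hneg uE.
have dv_mu k N : dv k (mu k N) = N.
  by apply/eqP/cmP => a; rewrite dv_ev mu_ev addnK.
have mu_dv k (N : {cmonom nat}) : (0 < N k)%N -> mu k (dv k N) = N.
  move=> N0; apply/eqP/cmP => a; rewrite mu_ev dv_ev.
  by case: (eqVneq k a) => [<-|_]; rewrite ?subn0 ?addn0 ?subnK.
have dvC k l N : dv k (dv l N) = dv l (dv k N).
  by apply/eqP/cmP => a; rewrite !dv_ev subnAC.
have muC k l N : mu k (mu l N) = mu l (mu k N).
  by apply/eqP/cmP => a; rewrite !mu_ev addnAC.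
have dv_muC k l N : k != l -> dv k (mu l N) = mu l (dv k N).
  move=> kl; apply/eqP/cmP => a; rewrite mu_ev !dv_ev mu_ev.
  case: (eqVneq k a) => [<-|_]; last by rewrite !subn0.
  by rewrite eq_sym (negbTE kl) !addn0.
have mixed k l p M : h (Posz k.+1) (h (Negz l) (V p M))
    - h (Negz l) (h (Posz k.+1) (V p M))
    = ((Posz k.+1) *+ (k == l))%:~R *: V p M.
  rewrite !hpos !hneg hZ hpos hneg mu_ev eq_sym.
  have [->|kl] := eqVneq k l; last first.
    by rewrite addn0 dv_muC // subrr mulr0n scale0r.
  rewrite dv_mu mulr1n -pmulrn addn1.
  have [Mk|Mk] := posnP (M l); first by rewrite Mk muln0 scale0r subr0 muln1.
  by rewrite mu_dv // -scalerBl mulnS natrD addrK.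
have basis p M :
    h i (h j (V p M)) - h j (h i (V p M)) = (i *+ (i + j == 0))%:~R *: V p M.
  case: i j => [[|i]|i] [[|j]|j].
  - by rewrite subrr mul0rn scale0r.
  - by rewrite hpos h0 !hZ h0 hpos sC subrr mul0rn scale0r.
  - by rewrite hneg h0 h0 hZ hneg subrr mul0rn scale0r.
  - by rewrite addr0 mulr0n scale0r hpos h0 !hZ h0 hpos sC subrr.
  - rewrite mulr0n scale0r !hpos !hZ !hpos !scalerA dvC -!natrM !dv_ev.
    rewrite [j == i]eq_sym; have [->|_] := eqVneq i j; first by rewrite subrr.
    by rewrite !subn0 mulnC subrr.
  - rewrite mixed NegzE subr_eq0.
    by have -> : (Posz i.+1 == Posz j.+1) = (i == j) by [].
  - by rewrite addr0 mulr0n scale0r hneg h0 h0 hZ hneg subrr.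
  - rewrite -opprB mixed NegzE addrC subr_eq0.
    have -> : (Posz j.+1 == Posz i.+1) = (j == i) by [].
    have [->|_] := eqVneq j i; last by rewrite !mulr0n !scale0r oppr0.
    by rewrite !mulr1n mulrNz scaleNr.
  - by rewrite mulr0n scale0r !hneg muC subrr.
have step c v : h i (h j (c *: v)) - h j (h i (c *: v))
    = c *: (h i (h j v) - h j (h i v)).
  by rewrite scalerBr -!hZ.
rewrite uE !hS -sumrB scaler_sumr; apply: eq_bigr => b _.
by rewrite step basis sC.
Qed.

(* | lambda > is sent to | lambda + sqrt (2m) >, see weightD *)
Definition shift : fock -> fock :=
  lin_ext (fun p M => fvec (p + (2 * m)%N%:Z) M).

(* The series exp (c * \sum_(n > 0) x_{n-1} / n * z^n) *)
Definition vexp (c : K) : nat -> polyN K :=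
  fps_exp (fun n => if n is k.+1 then (c / n%:R) *: varN K k else 0).

Definition exp_creat (k : int) : fock -> fock :=
  poly_act (fun j => heis (- j.+1%:Z)) (fps_coefz (vexp sq2m) k).

(* coefficient of z^(-l) in the second exponential of phi_{sqrt (2m)}(z) *)
Definition exp_annih (l : nat) : fock -> fock :=
  poly_act (fun j => heis j.+1%:Z) (vexp (- sq2m) l).

Definition wgt (M : {cmonom nat}) : nat :=
  (\sum_(k <- finsupp M) k.+1 * M k)%N.

Lemma wgtEw (M : {cmonom nat}) (d : {fset nat}) :
  (finsupp M `<=` d)%fset -> wgt M = (\sum_(k <- d) k.+1 * M k)%N.
Proof.
move=> le; rewrite /wgt (big_fset_incl _ le) //= => k _.
by rewrite -cmE_eq0 => /eqP ->; rewrite muln0.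
Qed.

Lemma wgtM (M N : {cmonom nat}) : wgt (mulcm M N) = (wgt M + wgt N)%N.
Proof.
pose d := (finsupp M `|` finsupp N `|` finsupp (mulcm M N))%fset.
rewrite !(@wgtEw _ d) ?fsubsetUr //.
- by rewrite -big_split; apply: eq_bigr => k _; rewrite /= mulcmE mulnDr.
- by apply: fsubset_trans (fsubsetUl _ _); rewrite fsubsetUr.
- by rewrite /d -fsetUA fsubsetUl.
Qed.

Lemma wgt1 : wgt mone = 0%N.
Proof. by rewrite /wgt mdom1 big_seq_fset0. Qed.

Lemma wgtU k : wgt (ucm k) = k.+1.
Proof. by rewrite /wgt mdomU big_seq_fset1 cmUU muln1. Qed.

Lemma wgt_div (M : {cmonom nat}) k : (0 < M k)%N -> (wgt (divcm M (ucm k)) + k.+1)%N = wgt M.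
Proof.
move=> M0; rewrite -(wgtU k) -wgtM; congr wgt.
apply/eqP/cmP => a; rewrite mulcmE divcmE ucmE.
by case: (eqVneq k a) => [<-|_]; rewrite ?subn0 ?addn0 ?subnK.
Qed.

Section Homogeneous.
Variables (T : choiceType) (wt : T -> nat).

Definition homog n (u : {malg K[T]}) : Prop :=
  forall b, u@_b != 0 -> wt b = n.

Lemma homog0 n : homog n 0.
Proof. by move=> b; rewrite mcoeff0 eqxx. Qed.

Lemma homogD n u v : homog n u -> homog n v -> homog n (u + v).
Proof.
move=> hu hv b; rewrite mcoeffD; have [u0|/hu //] := eqVneq u@_b 0.
by rewrite u0 add0r => /hv.
Qed.

Lemma homogZ n c u : homog n u -> homog n (c *: u).
Proof.
move=> hu b; rewrite mcoeffZ => nz; apply: hu.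
by apply: contraNneq nz => ->; rewrite mulr0.
Qed.

Lemma homog_sum n (I : eqType) (r : seq I) (F : I -> {malg K[T]}) :
  (forall i, i \in r -> homog n (F i)) -> homog n (\sum_(i <- r) F i).
Proof.
move=> hF; rewrite big_seq; elim/big_ind: _ => //; first exact: homog0.
exact: homogD.
Qed.

Lemma homogU b : homog (wt b) << b >>.
Proof. by move=> a; rewrite mcoeffU; case: (eqVneq b a) => [->|_] //; rewrite eqxx. Qed.

End Homogeneous.

Lemma homogM a b (P Q : polyN K) :
  homog wgt a P -> homog wgt b Q -> homog wgt (a + b) (P * Q).
Proof.
move=> hP hQ M; rewrite mcoeff_neq0 => /msuppM_le [N1 [N2 []]].
rewrite -!mcoeff_neq0 => /hP <- /hQ <- ->; exact: wgtM.
Qed.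

Lemma vexp_homog c l : homog wgt l (vexp c l).
Proof.
rewrite /vexp; set f := fun _ => _.
have hf n : homog wgt n (f n).
  case: n => [|k]; first exact: homog0.
  by apply: homogZ; rewrite -{1}(wgtU k); exact: homogU.
have hpow j n : homog wgt n (fps_pow f j n).
  elim: j n => [|j IHj] n.
    rewrite /fps_pow /= /fps_one; case: n => [|n]; last exact: homog0.
    by rewrite -{1}wgt1; exact: homogU.
  apply: homog_sum => k _; rewrite -{1}(subnKC (ltnSE (ltn_ord k))).
  exact: homogM.
by apply: homog_sum => j _; apply: homogZ; exact: hpow.
Qed.

Lemma exp_annih_eq0 l p M : (wgt M < l)%N -> exp_annih l (fvec p M) = 0.
Proof.
set w := wgt M => wl.
pose low (e : nat) (u : fock) := forall b, u@_b != 0 -> (wgt b.2 + e)%N = w.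
have low_sum e (I : eqType) (r : seq I) (F : I -> fock) :
    (forall i, i \in r -> low e (F i)) -> low e (\sum_(i <- r) F i).
  move=> hF; rewrite big_seq; elim/big_ind: _ => //.
    by move=> b; rewrite mcoeff0 eqxx.
  move=> u v hu hv b; rewrite mcoeffD; have [u0|/hu //] := eqVneq u@_b 0.
  by rewrite u0 add0r => /hv.
have lowZ e c u : (c != 0 -> low e u) -> low e (c *: u).
  move=> hu b; rewrite mcoeffZ mulf_eq0 negb_or => /andP[/hu]; exact.
have lowV e q N : (wgt N + e)%N = w -> low e (fvec q N).
  move=> eN b; rewrite /fvec mcoeffU.
  by case: (eqVneq (q, N) b) => [<- //|_]; rewrite mulr0n eqxx.
have low_heis e k u : low e u -> low (e + k.+1)%N (heis k.+1%:Z u).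
  move=> hu; apply: low_sum => -[q N]; rewrite -mcoeff_neq0 => /hu /= hN.
  apply/lowZ => _ /=; apply/lowZ => nz; apply: lowV.
  rewrite addnCA wgt_div; first by rewrite addnC.
  by case: (N k) nz; rewrite ?muln0 ?eqxx.
have low_act (N : {cmonom nat}) e u : low e u ->
    low (wgt N + e)%N (monom_act (fun j => heis j.+1%:Z) N u).
  rewrite /monom_act /wgt; elim: (enum_fset _) => [|k s IHs] /=.
    by rewrite big_nil.
  move=> /IHs {IHs}; rewrite big_cons -addnA mulnC.
  move: (_ + e)%N (foldr _ _ _) => {}e {}u hu.
  elim: (N k) => [//|n IHn] /=.
  by rewrite mulSn -addnA addnC; exact: low_heis.
have: low l (exp_annih l (fvec p M)).
  apply: low_sum => N; rewrite -mcoeff_neq0 => /vexp_homog <-.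
  by apply/lowZ => _; rewrite -[wgt N]addn0; apply/low_act/lowV/addn0.
move=> hl; apply/malgP => b; rewrite mcoeff0; apply/eqP.
by apply: contraLR wl => /hl <-; rewrite -leqNgt leq_addl.
Qed.

(* a_n, the coefficient of z^(-n-1) in phi_{sqrt (2m)}(z).  On << (p, M) >>,
   z^{sqrt (2m) h_0} is z^p (see weightK), and the coefficients of index l > wgt M
   of the second exponential vanish (see exp_annih_eq0). *)
Definition mode (n : int) : fock -> fock :=
  lin_ext (fun p M =>
    \sum_(l < (wgt M).+1)
      exp_creat (l%:Z - p - n - 1) (exp_annih l (shift (fvec p M)))).

Definition vac (p : int) : fock := fvec (- p) mone.

Lemma mode_vac (i p : int) : p <= i -> mode i (vac p) = 0.
Proof.
move=> pi; rewrite /mode /vac lin_ext_fvec wgt1 big_ord1 opprK add0r.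
have : p - i - 1 < 0 by rewrite subr_lt0 (le_lt_trans _ ltr01) // subr_le0.
rewrite /exp_creat; by case: (p - i - 1) => // n _; rewrite /poly_act msupp0 big_seq_fset0.
Qed.

(* the variable x_k stands for a_{-m-k} *)
Definition amode (k : nat) : fock -> fock := mode (- m%:Z - k%:Z).

Definition Vm : fock -> Prop := cyclic_sub amode (vac (1 - m%:Z)).

Definition phi_plus : nat -> polyN K := fun k => varN K k.

(* coefficient of z^s in the square of the i-th derivative of phi^+ *)
Definition phi_rel (t : nat * 'I_m) : polyN K :=
  let f := iter t.2 (@fps_deriv K (polyN K)) phi_plus in fps_mul f f t.1.

Definition quad_rel (t : nat * 'I_m) : polyN K :=
  \sum_(a1 < t.1.+1)
    let a2 := (t.1 - a1)%N in
    (a1 ^_ t.2 * a2 ^_ t.2)%N%:R *: (varN K a1 * varN K a2).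

End Fock.

(* Main.v *)
Require Import Defs.
From HB Require Import structures.
From mathcomp Require Import all_boot all_order all_algebra.
From mathcomp Require Import finmap monalg complex reals.
From mathcomp Require Import zify ring.

Set Implicit Arguments.
Unset Strict Implicit.
Unset Printing Implicit Defensive.

Import Order.TTheory GRing.Theory Num.Theory.
Local Open Scope ring_scope.

(** Write [x_k] for the variable that stands for [a_(-m-k)] and [v] for the vacuum
    [v_(1 - m)].

    On each summand [H_(p / sqrt (2m))], a copy of the polynomial ring in the
    [h_(-n)], the first exponential of the vertex operator multiplies by a series
    [E(z)], and the second one is an algebra morphism that sends [E(w)] to
    [(1 - w/z)^(2m) E(w)]. Hence
      [phi(z_1) ... phi(z_k) v
         ~ prod_(r < s) (z_s - z_r)^(2m) * E(z_1) ... E(z_k)],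
    up to a monomial in the [z_r]. Everything is read off from this formula.

    The relations hold because the square of the [i]-th derivative of [phi^+]
    differentiates [phi^+(z) phi^+(w)] only [2i < 2m] times before setting
    [z = w], which does not exhaust the factor [(z - w)^(2m)]; in terms of
    coefficients this is the vanishing of a [2m]-th finite difference
    ([op_relation], [quad_coef_vac]).

    There are no others. Call a monomial [x_(i_1) ... x_(i_k)] with decreasing
    indices spread if consecutive indices differ by at least [2m]. The spread
    monomials span the polynomials modulo the quadratic relations: for a given sum
    [s] of two indices the relations say that
      [sum_a q(a (s - a)) x_a x_(s-a)]
    vanishes for every polynomial [q] of degree less than [m], there are at most
    [m] pairs at distance less than [2m], and Lagrange interpolation isolates each
    of them ([close_pair]), so that any close pair can be moved apart
    ([spread_reduction]).

    The spread monomials act on [v] by linearly independent vectors: in the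
    coefficient of [z^i] in the formula above, the term of the product of
    differences with exponents [0, 2m, 4m, ...] gives the product of the coefficients of
    [E] with indices [mu_r = i_r - 2m (r - 1)], and all the others have index
    lists that strictly dominate [mu], hence a larger sum of squares
    ([vecs_triangular], [dom_sumsq]). As the coefficients of [E] are algebraically
    independent ([universal_specialization]), these leading terms are distinct
    ([leading_coefficients], [vecs_free]). *)

(** * Linear extension and the action of polynomials by commuting operators *)

Section LinearExtension.
Variables (K : fieldType) (T : choiceType) (V : lmodType K).

Definition lext (g : T -> V) (u : {malg K[T]}) : V :=
  \sum_(b <- msupp u) u@_b *: g b.

Lemma lextEw g (d : {fset T}) u :
  (msupp u `<=` d)%fset -> lext g u = \sum_(b <- d) u@_b *: g b.
Proof.
move=> le; rewrite /lext (big_fset_incl _ le) //= => b _ /mcoeff_outdom ->.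
by rewrite scale0r.
Qed.

Lemma lext_is_linear g : linear (lext g).
Proof.
move=> c u v; pose d := (msupp u `|` msupp v `|` msupp (c *: u + v))%fset.
rewrite !(@lextEw g d) ?fsubsetUr //; last first.
- by rewrite /d -fsetUA fsubsetUl.
- by apply: fsubset_trans (fsubsetUl _ _); rewrite fsubsetUr.
rewrite scaler_sumr -big_split /=; apply: eq_bigr => b _.
by rewrite mcoeffD mcoeffZ scalerDl scalerA.
Qed.

HB.instance Definition _ g :=
  GRing.isLinear.Build K {malg K[T]} V *:%R (lext g) (lext_is_linear g).

Lemma lextU g b : lext g << b >> = g b.
Proof. by rewrite /lext msuppU oner_eq0 big_seq_fset1 mcoeffUU scale1r. Qed.

Lemma malg_sumE (u : {malg K[T]}) : u = \sum_(b <- msupp u) u@_b *: << b >>.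
Proof.
rewrite {1}[u]monalgE; apply: eq_bigr => b _.
by apply/malgP => k; rewrite mcoeffZ !mcoeffU mulrnAr mulr1.
Qed.

Lemma linear_on_basis (f g : {malg K[T]} -> V) :
  linear f -> linear g -> (forall b, f << b >> = g << b >>) -> f =1 g.
Proof.
move=> fL gL fg u.
pose fl := HB.pack_for {linear {malg K[T]} -> V} f
  (GRing.isLinear.Build _ _ _ _ f fL).
pose gl := HB.pack_for {linear {malg K[T]} -> V} g
  (GRing.isLinear.Build _ _ _ _ g gL).
rewrite -[f u]/(fl u) -[g u]/(gl u) [u]malg_sumE !linear_sum.
by apply: eq_bigr => b _; rewrite !linearZ /= fg.
Qed.

End LinearExtension.

(** Locked, so that distinct monomials are never compared by unfolding them to
    finitely supported functions, which is intractable. *)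
HB.lock Definition mon (K : fieldType) (M : {cmonom nat}) : polyN K := << M >>.

Section Monomials.
Variable K : fieldType.
Local Notation S := (polyN K).
Local Notation mon := (mon K).

Lemma varNE k : varN K k = mon (ucm k).
Proof. by rewrite mon.unlock. Qed.

Lemma mon1 : mon mone = 1.
Proof. by rewrite mon.unlock. Qed.

Lemma monM M N : mon M * mon N = mon (mulcm M N).
Proof. by rewrite mon.unlock malgM_def fgmulUU mulr1. Qed.

Lemma mcoeff_mon M N : (mon M)@_N = (M == N)%:R.
Proof. by rewrite mon.unlock; exact: mcoeffU. Qed.

Lemma polyN_sumE (P : S) : P = \sum_(M <- msupp P) P@_M *: mon M.
Proof. by rewrite mon.unlock; exact: malg_sumE. Qed.

Lemma lext_mon (V : lmodType K) (g : {cmonom nat} -> V) M : lext g (mon M) = g M.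
Proof. by rewrite mon.unlock lextU. Qed.

Lemma polyN_linear_eq (V : lmodType K) (f g : S -> V) :
  linear f -> linear g -> (forall M, f (mon M) = g (mon M)) -> f =1 g.
Proof. by rewrite mon.unlock; exact: linear_on_basis. Qed.

Lemma cmonom_ind (Q : {cmonom nat} -> Prop) :
  Q mone -> (forall k M, Q M -> Q (mulcm (ucm k) M)) -> forall M, Q M.
Proof.
move=> Q1 QM M; have [n] := ubnP (mdeg M); elim: n M => // n IHn M ltn.
have [/eqP|[k kM]] := fset_0Vmem (finsupp M).
  move=> /eqP M0; suff -> : M = mone by [].
  apply/eqP/cmP => i; rewrite cm1; apply/eqP.
  by rewrite cmE_eq0 M0 in_fset0.
have MK : M = mulcm (ucm k) (divcm M (ucm k)).
  apply/eqP/cmP => a; rewrite mulcmE divcmE ucmE.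
  have [<-|_] := eqVneq k a; last by rewrite subn0.
  by rewrite subnKC // lt0n cmE_neq0.
rewrite MK; apply/QM/IHn; move: ltn; rewrite {1}MK.
by have /= -> := mdegM (ucm k) (divcm M (ucm k)); rewrite mdegU add1n ltnS.
Qed.

Lemma polyN_ind (Q : S -> Prop) :
  (forall c P R, Q P -> Q R -> Q (c *: P + R)) -> Q 1 ->
  (forall k P, Q P -> Q (mon (ucm k) * P)) -> forall P, Q P.
Proof.
move=> Ql Q1 QX P.
have Q0 : Q 0 by rewrite -[0](addNr 1) -scaleN1r; apply: Ql.
have QU M : Q (mon M).
  by elim/cmonom_ind: M => [|k M QM]; [rewrite mon1 | rewrite -monM; apply: QX].
rewrite [P]polyN_sumE; apply: big_rec => [|b u _ Qu]; first exact: Q0.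
by apply: Ql; [exact: QU | exact: Qu].
Qed.

End Monomials.

Section PolyAct.
Variables (K : fieldType) (E : lmodType K) (op : nat -> E -> E).
Local Notation S := (polyN K).

Lemma poly_act_is_linear v : linear (fun P => poly_act op P v).
Proof. exact: (@lext_is_linear _ _ _ (fun M => monom_act op M v)). Qed.

Lemma poly_act_lin c P Q v :
  poly_act op (c *: P + Q) v = c *: poly_act op P v + poly_act op Q v.
Proof. exact: poly_act_is_linear. Qed.

Lemma poly_actD P Q v :
  poly_act op (P + Q) v = poly_act op P v + poly_act op Q v.
Proof. by have := poly_act_lin 1 P Q v; rewrite !scale1r. Qed.

Lemma poly_act0 v : poly_act op 0 v = 0.
Proof. by rewrite /poly_act msupp0 big_seq_fset0. Qed.

Lemma poly_actZ c P v : poly_act op (c *: P) v = c *: poly_act op P v.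
Proof. by have := poly_act_lin c P 0 v; rewrite poly_act0 !addr0. Qed.

Lemma poly_act_sum (I : Type) (r : seq I) (Pr : pred I) (F : I -> S) v :
  poly_act op (\sum_(i <- r | Pr i) F i) v
    = \sum_(i <- r | Pr i) poly_act op (F i) v.
Proof. exact: (linear_sum (lext (fun M => monom_act op M v))). Qed.

Lemma poly_actU M v : poly_act op (mon K M) v = monom_act op M v.
Proof. exact: (lext_mon (fun M => monom_act op M v)). Qed.

Lemma poly_act1 v : poly_act op 1 v = v.
Proof. by rewrite -mon1 poly_actU /monom_act mdom1. Qed.

Lemma poly_actX k v : poly_act op (mon K (ucm k)) v = op k v.
Proof.
rewrite poly_actU /monom_act mdomU.
have -> : enum_fset [fset k]%fset = [:: k] :> seq nat.
  apply: perm_small_eq => //; apply: uniq_perm; rewrite ?fset_uniq //.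
  by move=> i; rewrite in_fset1 inE.
by rewrite /= cmUU.
Qed.

Hypothesis opL : forall k, linear (op k).
Hypothesis opC : forall i j v, op i (op j v) = op j (op i v).

Lemma op_iterC i j a b v :
  iter a (op i) (iter b (op j) v) = iter b (op j) (iter a (op i) v).
Proof.
have step c w : iter c (op i) (op j w) = op j (iter c (op i) w).
  by elim: c => //= c ->; rewrite opC.
by elim: b v => //= b IHb v; rewrite step IHb.
Qed.

Let act (M : nat -> nat) (s : seq nat) v :=
  foldr (fun k => iter (M k) (op k)) v s.

Lemma act_iter M s i a v : act M s (iter a (op i) v) = iter a (op i) (act M s v).
Proof. by elim: s => //= k s ->; rewrite op_iterC. Qed.

Lemma act_perm M s1 s2 v : perm_eq s1 s2 -> act M s1 v = act M s2 v.
Proof.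
elim: s1 s2 => [|k s1 IHs] s2 eqs.
  by move: (perm_size eqs) => /esym/size0nil ->.
have ks2 : k \in s2 by rewrite -(perm_mem eqs) mem_head.
have {}eqs : perm_eq s1 (rem k s2).
  by rewrite -(perm_cons k); apply: (perm_trans eqs); apply: perm_to_rem.
rewrite /= (IHs _ eqs) => {IHs eqs}.
elim: s2 ks2 => // j s2 IHs; rewrite inE /= [j == k]eq_sym.
have [->//|_ /= ks] := eqVneq k j.
by rewrite -IHs // op_iterC.
Qed.

Lemma act_filter (M : nat -> nat) s v :
  act M s v = act M [seq k <- s | M k != 0%N] v.
Proof. by elim: s => //= k s ->; case: eqP => // ->. Qed.

Lemma monom_act_iota n (M : {cmonom nat}) v :
  (forall k, n <= k -> M k = 0)%N -> monom_act op M v = act M (iota 0 n) v.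
Proof.
move=> Mn; rewrite [RHS]act_filter; apply: act_perm.
apply: uniq_perm; rewrite ?filter_uniq ?iota_uniq ?fset_uniq //.
move=> k; rewrite mem_filter mem_iota /= add0n cmE_neq0.
have [//|/Mn] := ltnP k n; first by rewrite andbT.
by move=> /eqP; rewrite cmE_eq0 andbF => /negbTE.
Qed.

Lemma act_mul (M N : nat -> nat) s v :
  act (fun k => M k + N k)%N s v = act M s (act N s v).
Proof. by elim: s => //= k s ->; rewrite iterD act_iter. Qed.

Lemma monom_bound (M : {cmonom nat}) :
  exists n, forall k, (n <= k -> M k = 0)%N.
Proof.
exists (\max_(k <- finsupp M) k).+1%N => k lek; apply/eqP; rewrite cmE_eq0.
apply/negP => kM; move: lek; rewrite ltnNge => /negP; apply.
exact: (@leq_bigmax_seq _ _ xpredT (fun i : nat => i)).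
Qed.

Lemma monom_actM M N v :
  monom_act op (mulcm M N) v = monom_act op M (monom_act op N v).
Proof.
have [a Ma] := monom_bound M; have [b Nb] := monom_bound N.
have Mab k : (maxn a b <= k)%N -> M k = 0%N by rewrite geq_max => /andP[/Ma].
have Nab k : (maxn a b <= k)%N -> N k = 0%N by rewrite geq_max => /andP[_ /Nb].
have MNab k : (maxn a b <= k)%N -> mulcm M N k = 0%N.
  by move=> le; rewrite mulcmE Mab ?Nab.
rewrite (monom_act_iota _ Mab) (monom_act_iota _ Nab) (monom_act_iota _ MNab).
rewrite -act_mul /act; elim: (iota _ _) => //= k s ->.
by rewrite mulcmE.
Qed.

Lemma monom_act_linear M : linear (monom_act op M).
Proof.
move=> c u v; rewrite /monom_act; elim: (enum_fset _) => //= k s ->.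
by elim: (M k) => //= n ->; rewrite opL.
Qed.

Lemma poly_act_linear P : linear (poly_act op P).
Proof.
move=> c u v; rewrite /poly_act scaler_sumr -big_split /=.
by apply: eq_bigr => M _; rewrite monom_act_linear scalerDr !scalerA mulrC.
Qed.

(** Commuting linear operators make the space a module over the polynomials: the
    order in which a monomial applies them is immaterial, so the exponents of two
    monomials can be merged on a common list of variables. *)
Lemma poly_actM P Q v : poly_act op (P * Q) v = poly_act op P (poly_act op Q v).
Proof.
move: P; apply: polyN_linear_eq => [c P R|c P R|M].
- by rewrite mulrDl -scalerAl poly_act_lin.
- by rewrite poly_act_lin.
rewrite poly_actU; move: Q; apply: polyN_linear_eq => [c P R|c P R|N].
- by rewrite mulrDr -scalerAr poly_act_lin.
- by rewrite poly_act_lin monom_act_linear.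
by rewrite monM !poly_actU monom_actM.
Qed.

End PolyAct.

Lemma poly_act_intertwine (K : fieldType) (E F : lmodType K)
    (op : nat -> E -> E) (op' : nat -> F -> F) (f : E -> F) P v :
  linear f -> (forall k w, f (op k w) = op' k (f w)) ->
  f (poly_act op P v) = poly_act op' P (f v).
Proof.
move=> fL fop.
pose fl := HB.pack_for {linear E -> F} f (GRing.isLinear.Build _ _ _ _ f fL).
rewrite /poly_act -[f _]/(fl _) linear_sum; apply: eq_bigr => M _.
rewrite linearZ /= /monom_act; congr (_ *: _).
elim: (enum_fset _) => //= k s <-.
by elim: (M k) => //= n IHn; rewrite fop IHn.
Qed.

Section Evaluation.
Variables (K : fieldType) (A : comAlgType K) (t : nat -> A).

(** Evaluation at [t], as an action by multiplications, so that multiplicativity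
    is an instance of [poly_actM]. *)
Definition peval (P : polyN K) : A := poly_act (fun k (f : A) => t k * f) P 1.

Lemma peval_lin c P Q : peval (c *: P + Q) = c *: peval P + peval Q.
Proof. exact: poly_act_lin. Qed.

Lemma pevalX k : peval (mon K (ucm k)) = t k.
Proof. by rewrite /peval poly_actX mulr1. Qed.

Lemma peval1 : peval 1 = 1.
Proof. exact: poly_act1. Qed.

Lemma poly_act_mulE P f : poly_act (fun k (g : A) => t k * g) P f = peval P * f.
Proof.
rewrite /peval mulrC.
rewrite (@poly_act_intertwine _ _ _ _ (fun k g => t k * g) (fun g => f * g)).
- by rewrite mulr1.
- by move=> c u v; rewrite mulrDr scalerAr.
- by move=> k w; rewrite mulrCA.
Qed.

Lemma pevalM P Q : peval (P * Q) = peval P * peval Q.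
Proof.
rewrite -poly_act_mulE /peval poly_actM //.
- by move=> k c u v; rewrite mulrDr scalerAr.
- by move=> i j v; rewrite mulrCA.
Qed.

End Evaluation.

Lemma peval_var (K : fieldType) (P : polyN K) : peval (fun k => mon K (ucm k)) P = P.
Proof.
elim/polyN_ind: P => [c P Q IP IQ||k P IP].
- by rewrite peval_lin IP IQ.
- exact: peval1.
- by rewrite pevalM pevalX IP.
Qed.

(** * The exponential series *)

Section ExpSeries.
Variables (K : numFieldType) (A : comAlgType K).
Implicit Types f g h : nat -> A.

(** The derivation [z d/dz], preferred to [d/dz] because it keeps the index. *)
Definition fps_theta f : nat -> A := fun n => f n *+ n.

Let trunc N f : {poly A} := \poly_(i < N) f i.

Lemma fps_mul_trunc N f g n :
  (n < N)%N -> fps_mul f g n = (trunc N f * trunc N g)`_n.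
Proof.
move=> ltnN; rewrite coefM; apply: eq_bigr => k _.
rewrite !coef_poly (leq_ltn_trans (leq_subr _ _) ltnN).
by rewrite (leq_trans (ltn_ord k) ltnN).
Qed.

Lemma fps_mulCA f g h : fps_mul f (fps_mul g h) =1 fps_mul g (fps_mul f h).
Proof.
have assoc f1 f2 f3 n : fps_mul f1 (fps_mul f2 f3) n
    = (trunc n.+1 f1 * (trunc n.+1 f2 * trunc n.+1 f3))`_n.
  rewrite coefM; apply: eq_bigr => k _; rewrite coef_poly ltn_ord.
  by rewrite (@fps_mul_trunc n.+1) // ltnS leq_subr.
by move=> n; rewrite !assoc mulrCA.
Qed.

Lemma fps_mulr_ext f g h n : g =1 h -> fps_mul f g n = fps_mul f h n.
Proof. by move=> gh; apply: eq_bigr => k _; rewrite gh. Qed.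

Lemma fps_mulrMn f g k n : fps_mul f (fun i => g i *+ k) n = fps_mul f g n *+ k.
Proof. by rewrite /fps_mul -sumrMnl; apply: eq_bigr => i _; rewrite mulrnAr. Qed.

Lemma fps_thetaM f g n :
  fps_theta (fps_mul f g) n
    = fps_mul (fps_theta f) g n + fps_mul f (fps_theta g) n.
Proof.
rewrite /fps_theta /fps_mul -sumrMnl -big_split; apply: eq_bigr => k _ /=.
by rewrite mulrnAl mulrnAr -mulrnDr subnKC // -ltnS.
Qed.

Lemma fps_thetaX f j n :
  fps_theta (fps_pow f j.+1) n = fps_mul (fps_theta f) (fps_pow f j) n *+ j.+1.
Proof.
elim: j n => [|j IHj] n; rewrite [LHS]fps_thetaM.
  rewrite mulr1n [X in _ + X]big1 ?addr0 // => k _.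
  by rewrite /fps_theta /fps_pow /= /fps_one; case: eqP => [->|_];
    rewrite ?mulr0n ?mul0rn mulr0.
by rewrite (fps_mulr_ext _ _ IHj) fps_mulrMn fps_mulCA [RHS]mulrS.
Qed.

Lemma fps_pow_eq0 f j n : f 0%N = 0 -> (n < j)%N -> fps_pow f j n = 0.
Proof.
move=> f0; elim: j n => // j IHj n ltnj; apply: big1 => -[[|k] ltk] _ /=.
  by rewrite f0 mul0r.
rewrite [X in _ * X](_ : _ = 0) ?mulr0 //; apply: (IHj (n - k.+1)%N); lia.
Qed.

(** The differential equation [z E' = (z f') E] for [E = exp f]: term by term it is
    [z (f^j)' = j (z f') f^(j-1)]. It replaces the exponential by a recursion. *)
Lemma fps_exp_theta f n : f 0%N = 0 ->
  fps_theta (fps_exp f) n = fps_mul (fps_theta f) (fps_exp f) n.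
Proof.
move=> f0; rewrite /fps_theta {1}/fps_exp -sumrMnl big_ord_recl.
rewrite [X in X + _](_ : _ = 0) ?add0r; last first.
  by case: n => [|n]; rewrite ?mulr0n // [fps_pow _ _ _]/(0 : A) scaler0 mul0rn.
transitivity (\sum_(j < n) (j`!%:R : K)^-1 *: fps_mul (fps_theta f) (fps_pow f j) n).
  apply: eq_bigr => j _; rewrite lift0 scalerMnr.
  have := fps_thetaX f j n; rewrite /fps_theta => ->.
  rewrite -scaler_nat scalerA factS natrM invfM mulrC mulrA divff ?mul1r //.
  by rewrite pnatr_eq0.
rewrite /fps_mul; under eq_bigr do rewrite scaler_sumr.
rewrite exchange_big; apply: eq_bigr => k _ /=; rewrite /fps_exp.
have [->|k0] := eqVneq (k : nat) 0%N.
  rewrite /fps_theta mulr0n mul0r big1 // => j _.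
  by rewrite mul0r scaler0.
rewrite mulr_sumr (@big_ord_widen_cond _ _ _ (n - k).+1 n xpredT
  (fun j => fps_theta f k * ((j`!%:R : K)^-1 *: fps_pow f j (n - k)%N))); last first.
  by have := ltn_ord k; lia.
rewrite [RHS]big_mkcond /=; apply: eq_bigr => j _; rewrite scalerAr.
by case: ltnP => // lej; rewrite fps_pow_eq0 ?scaler0 ?mulr0 //.
Qed.

End ExpSeries.

Section VertexExp.
Variable K : numClosedFieldType.
Local Notation X k := (mon K (ucm (k%N : nat))).

(** Newton's recursion, with the variables as power sums: the logarithmic
    derivative of the exponential has the variables as coefficients. *)
Lemma vexp_rec (c : K) n :
  vexp c n *+ n = c *: \sum_(k < n) X k * vexp c (n - k.+1)%N.
Proof.
have [f [-> f0 fS]] : exists f : nat -> polyN K, [/\ vexp c = fps_exp f,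
    f 0%N = 0 & forall k, f k.+1 = (c / k.+1%:R) *: X k].
  exists (fun i => if i is k.+1 then (c / i%:R) *: varN K k else 0).
  by split; [by [] | by [] | move=> k; rewrite varNE].
have := @fps_exp_theta K _ f n f0; rewrite /fps_theta => ->.
rewrite /fps_mul big_ord_recl mulr0n mul0r add0r scaler_sumr.
apply: eq_bigr => k _; rewrite lift0 fS.
by rewrite -scaler_nat scalerA mulrCA mulfV ?pnatr_eq0 // mulr1 scalerAl.
Qed.

Lemma vexp0 (c : K) : vexp c 0 = 1.
Proof.
by rewrite /vexp /fps_exp big_ord1 fact0 invr1 scale1r.
Qed.

End VertexExp.

(** * The Fock space as a sum of copies of the polynomial ring *)

Section Leibniz.
Variables (K : fieldType) (A : comAlgType K) (D : A -> A) (g : A).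
Hypothesis DL : linear D.

Lemma linear_mull : linear (fun f => D (f * g)).
Proof. by move=> c u v; rewrite mulrDl -scalerAl DL. Qed.

Lemma linear_mulr : linear (fun f => D (g * f)).
Proof. by move=> c u v; rewrite mulrDr -scalerAr DL. Qed.

Lemma linear_leibnizl : linear (fun f => D f * g + f * D g).
Proof.
by move=> c u v; rewrite DL !mulrDl -!scalerAl addrACA -scalerDr.
Qed.

Lemma linear_leibnizr : linear (fun f => D g * f + g * D f).
Proof.
by move=> c u v; rewrite DL !mulrDr -!scalerAr addrACA -scalerDr.
Qed.

End Leibniz.

(** The summand [H_(p / sqrt (2m))], as a copy of the polynomial ring in which the
    variable of index [k] is [h_(-(k+1))]. This and the following operations are
    locked for the same reason as the monomials. *)
HB.lock Definition emb (K : numClosedFieldType) (p : int) (f : polyN K) : fock K :=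
  lext (fun M => fvec K p M) f.

(** The operator [h_(k+1)], which is [(k + 1)] times the partial derivative in
    the variable of index [k]. *)
HB.lock Definition Dh (K : numClosedFieldType) (k : nat) (f : polyN K) : polyN K :=
  lext (fun M : {cmonom nat} => (k.+1 * M k)%N%:R *: mon K (divcm M (ucm k))) f.

(** The coefficients of the two exponentials in the vertex operator: the first
    acts by multiplication by [eZ], the second through [sig]. *)
HB.lock Definition eZ (K : numClosedFieldType) (m : nat) (k : int) : polyN K :=
  fps_coefz (vexp (sqrtC (2 * m)%N%:R)) k.

HB.lock Definition sig (K : numClosedFieldType) (m l : nat) (f : polyN K) : polyN K :=
  poly_act (@Dh K) (vexp (- sqrtC (2 * m)%N%:R) l) f.

(** The operator that [a_n] induces on polynomials; it only depends on
    [j = - p - n - 1], where [p] is the sector on which [a_n] acts. *)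
HB.lock Definition opX (K : numClosedFieldType) (m : nat) (j : int) (f : polyN K)
    : polyN K :=
  lext (fun M => \sum_(l < (wgt M).+1) eZ K m (l%:Z + j) * sig m l (mon K M)) f.

Lemma sum_ord_extend (V : zmodType) b a (F : nat -> V) :
  (a <= b)%N -> (forall l, (a <= l)%N -> F l = 0) ->
  \sum_(l < b) F l = \sum_(l < a) F l.
Proof.
move=> /subnKC <- F0; rewrite big_split_ord /= [X in _ + X]big1 ?addr0 //.
by move=> i _; rewrite F0 ?leq_addr.
Qed.

Section FockModel.
Variables (K : numClosedFieldType) (m : nat).
Local Notation S := (polyN K).
Local Notation X k := (mon K (ucm (k%N : nat))).
Local Notation sq2m := (sqrtC (2 * m)%N%:R : K).
Local Notation sig := (@sig K m).
Local Notation eZ := (@eZ K m).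
Local Notation opX := (@opX K m).
Local Notation Dh := (@Dh K).
Local Notation emb := (@emb K).

Lemma emb_is_linear p : linear (emb p).
Proof. by rewrite emb.unlock; exact: lext_is_linear. Qed.

HB.instance Definition _ p :=
  GRing.isLinear.Build K S (fock K) *:%R (emb p) (emb_is_linear p).

Lemma emb_mon p M : emb p (mon K M) = fvec K p M.
Proof. by rewrite emb.unlock lext_mon. Qed.

Lemma mcoeff_emb p f q N : (emb p f)@_(q, N) = if p == q then f@_N else 0.
Proof.
have -> : emb p f = \sum_(M <- msupp f) f@_M *: fvec K p M.
  by rewrite emb.unlock.
rewrite [in RHS](polyN_sumE f) !raddf_sum /=.
case: ifP => [/eqP <-|npq].
  apply: eq_bigr => M _; rewrite !mcoeffZ mcoeff_mon /fvec mcoeffU.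
  by rewrite xpair_eqE eqxx.
by apply: big1 => M _; rewrite mcoeffZ /fvec mcoeffU xpair_eqE npq mulr0.
Qed.

Lemma emb_inj p : injective (emb p).
Proof.
move=> f g fg; apply/malgP => M.
have := congr1 (fun u : fock K => u@_(p, M)) fg.
by rewrite (mcoeff_emb p f) (mcoeff_emb p g) eqxx.
Qed.

Lemma Dh_linear k : linear (Dh k).
Proof. by rewrite Dh.unlock; exact: lext_is_linear. Qed.

HB.instance Definition _ k := GRing.isLinear.Build K S S *:%R (Dh k) (Dh_linear k).

Lemma Dh_mon k M : Dh k (mon K M) = (k.+1 * M k)%N%:R *: mon K (divcm M (ucm k)).
Proof. by rewrite Dh.unlock lext_mon. Qed.

Lemma heis_pos k p f : heis m k.+1%:Z (emb p f) = emb p (Dh k f).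
Proof.
move: f; apply: polyN_linear_eq => [c u v|c u v|M]; rewrite ?linearP //.
by rewrite Dh_mon emb_mon /heis lin_ext_fvec linearZ /= emb_mon.
Qed.

Lemma heis_neg k p f : heis m (- k.+1%:Z) (emb p f) = emb p (X k * f).
Proof.
move: f; apply: polyN_linear_eq => [c u v|c u v|M]; rewrite ?linearP //.
  by rewrite mulrDr -scalerAr linearP.
by rewrite -NegzE monM !emb_mon /heis lin_ext_fvec mulcmC.
Qed.

Lemma DhC i j f : Dh i (Dh j f) = Dh j (Dh i f).
Proof.
apply: (@emb_inj 0); apply/eqP; rewrite -!heis_pos -subr_eq0.
by rewrite heis_comm scale0r.
Qed.

Lemma DhM k f g : Dh k (f * g) = Dh k f * g + f * Dh k g.
Proof.
have half (M N : {cmonom nat}) :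
    (M k)%:R *: mon K (divcm (mulcm M N) (ucm k))
    = (M k)%:R *: (mon K (divcm M (ucm k)) * mon K N).
  have [->|Mk] := posnP (M k); first by rewrite !scale0r.
  rewrite monM; congr (_ *: mon K _); apply/eqP/cmP => i.
  rewrite !(mulcmE, divcmE, ucmE); case: eqVneq => [<-|_]; last by rewrite !subn0.
  by rewrite addnBAC.
apply: (polyN_linear_eq (linear_mull _ (Dh_linear k))
  (linear_leibnizl _ (Dh_linear k))) => M.
move: g; apply: (polyN_linear_eq (linear_mulr _ (Dh_linear k))
  (linear_leibnizr _ (Dh_linear k))) => N.
rewrite monM !Dh_mon mulcmE mulnDr natrD scalerDl; congr (_ + _).
  by rewrite natrM -scalerAl -!scalerA half.
by rewrite mulcmC natrM -scalerAr -!scalerA half mulrC.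
Qed.

Lemma Dh_var k j : Dh k (X j) = (k.+1 * (j == k))%N%:R *: 1.
Proof.
rewrite Dh_mon ucmE; have [->|_] := eqVneq j k; last by rewrite muln0 !scale0r.
rewrite -mon1; congr (_ *: mon K _).
by apply/eqP/cmP => i; rewrite divcmE subnn cm1.
Qed.

Lemma sig_is_linear l : linear (sig l).
Proof. by rewrite sig.unlock; exact: poly_act_linear Dh_linear _. Qed.

HB.instance Definition _ l :=
  GRing.isLinear.Build K S S *:%R (sig l) (sig_is_linear l).

Lemma exp_creatE k p f : exp_creat m k (emb p f) = emb p (eZ k * f).
Proof.
rewrite /exp_creat eZ.unlock.
rewrite -(@poly_act_intertwine _ _ _ (fun j g => X j * g) _ (emb p)).
- by rewrite poly_act_mulE peval_var.
- by move=> c u v; rewrite linearP.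
- by move=> j w; rewrite heis_neg.
Qed.

Lemma exp_annihE l p f : exp_annih m l (emb p f) = emb p (sig l f).
Proof.
rewrite /exp_annih sig.unlock -(@poly_act_intertwine _ _ _ Dh _ (emb p)) //.
- by move=> c u v; rewrite linearP.
- by move=> j w; rewrite heis_pos.
Qed.

Lemma sigC i j f : sig i (sig j f) = sig j (sig i f).
Proof.
by rewrite sig.unlock -!(poly_actM Dh_linear DhC) mulrC.
Qed.

Lemma sig0 f : sig 0 f = f.
Proof. by rewrite sig.unlock vexp0 poly_act1. Qed.

Lemma sig_rec l f :
  sig l f *+ l = (- sq2m) *: \sum_(k < l) Dh k (sig (l - k.+1) f).
Proof.
rewrite -scaler_nat sig.unlock -poly_actZ scaler_nat vexp_rec poly_actZ poly_act_sum.
congr (_ *: _); apply: eq_bigr => k _.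
by rewrite (poly_actM Dh_linear DhC) poly_actX.
Qed.

Lemma eZ_nat (n : nat) : eZ n = vexp sq2m n.
Proof. by rewrite eZ.unlock. Qed.

Lemma eZ_neg (n : int) : n < 0 -> eZ n = 0.
Proof. by rewrite eZ.unlock; case: n. Qed.

Lemma eZ0 : eZ 0 = 1.
Proof. by rewrite eZ_nat vexp0. Qed.

Lemma eZ_rec (n : nat) :
  eZ n *+ n = sq2m *: \sum_(k < n) X k * eZ (n%:Z - k.+1%:Z).
Proof.
have step (k : 'I_n) : eZ (n%:Z - k.+1%:Z) = vexp sq2m (n - k.+1)%N.
  by rewrite subzn ?eZ_nat.
under [in RHS]eq_bigr => k _ do rewrite step.
by rewrite eZ_nat vexp_rec.
Qed.

Lemma sqr2m : sq2m * sq2m = (2 * m)%N%:R.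
Proof. by rewrite -expr2 sqrtCK. Qed.

Lemma sig_mon_eq0 l M : (wgt M < l)%N -> sig l (mon K M) = 0.
Proof.
move=> lt; apply: (@emb_inj 0); rewrite -exp_annihE emb_mon exp_annih_eq0 //.
by rewrite linear0.
Qed.

Lemma opX_is_linear j : linear (opX j).
Proof. by rewrite opX.unlock; exact: lext_is_linear. Qed.

Lemma opXE j f L : (forall l, (L <= l)%N -> sig l f = 0) ->
  opX j f = \sum_(l < L) eZ (l%:Z + j) * sig l f.
Proof.
move=> sL; pose W := (\max_(M <- msupp f) wgt M).+1.
rewrite -(@sum_ord_extend _ (maxn L W) L (fun l => eZ (l%:Z + j) * sig l f));
  [|exact: leq_maxl|by move=> l /sL ->; rewrite mulr0].
rewrite opX.unlock /lext.
transitivity (\sum_(M <- msupp f) f@_M *: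
    \sum_(l < maxn L W) eZ (l%:Z + j) * sig l (mon K M)).
  apply: eq_big_seq => M Mf; congr (_ *: _).
  rewrite -(@sum_ord_extend _ (maxn L W) (wgt M).+1
    (fun l => eZ (l%:Z + j) * sig l (mon K M))) //.
    by rewrite leq_max /W ltnS (@leq_bigmax_seq _ _ xpredT (@wgt)) ?orbT.
  by move=> l lt; rewrite sig_mon_eq0 ?mulr0.
under eq_bigr do rewrite scaler_sumr.
rewrite exchange_big; apply: eq_bigr => l _ /=.
rewrite {3}(polyN_sumE f) linear_sum mulr_sumr; apply: eq_bigr => M _.
by rewrite linearZ /= scalerAr.
Qed.

Lemma mode_linear n : linear (@mode K m n).
Proof. exact: lin_ext_is_linear. Qed.

Lemma mode_emb n p f :
  mode m n (emb p f) = emb (p + (2 * m)%N%:Z) (opX (- p - n - 1) f).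
Proof.
move: f; apply: polyN_linear_eq => [c u v|c u v|M].
- by rewrite linearP mode_linear.
- by rewrite opX_is_linear linearP.
rewrite emb_mon /mode lin_ext_fvec /shift lin_ext_fvec -emb_mon.
rewrite (@opXE _ _ (wgt M).+1); last by move=> l lt; apply: sig_mon_eq0.
rewrite linear_sum; apply: eq_bigr => l _.
by rewrite exp_annihE exp_creatE !addrA.
Qed.

End FockModel.

(** * Finite differences *)

Section FiniteDifferences.
Variable K : numFieldType.
Implicit Types p : {poly K}.

(** The coefficients of [(1 - t)^N]. *)
Definition sbin N a : K := (-1) ^+ a * 'C(N, a)%:R.

Lemma sbin_small N a : (N < a)%N -> sbin N a = 0.
Proof. by move=> lt; rewrite /sbin bin_small ?mulr0. Qed.

Lemma sbin0 N : sbin N 0 = 1.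
Proof. by rewrite /sbin bin0 mulr1. Qed.

Lemma sbinS N a : sbin N.+1 a.+1 = sbin N a.+1 - sbin N a.
Proof. by rewrite /sbin binS natrD exprS; ring. Qed.

Lemma size_poly_diff p N : (size p <= N.+1)%N ->
  (size (p - (p \Po ('X - 1%:P)))%R <= N)%N.
Proof.
move=> sp; apply/leq_sizeP => j leNj; rewrite coefB.
have szc : size (p \Po ('X - 1%:P)) = size p.
  by apply: size_comp_poly2; rewrite size_XsubC.
have [ltj|gej] := ltnP j (size p); last first.
  by rewrite !nth_default ?subrr // szc.
have jE : j = (size p).-1 by lia.
have := @lead_coef_comp _ p ('X - 1%:P).
rewrite size_XsubC lead_coefXsubC expr1n mulr1 => /(_ isT).
by rewrite !lead_coefE szc -jE => ->; rewrite subrr.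
Qed.

Lemma sum_sbinS N (F : nat -> K) :
  \sum_(j < N.+2) sbin N.+1 j * F j = \sum_(j < N.+1) sbin N j * (F j - F j.+1).
Proof.
have shift : F 0%N + \sum_(j < N.+1) sbin N j.+1 * F j.+1
    = \sum_(j < N.+1) sbin N j * F j.
  transitivity (\sum_(j < N.+2) sbin N j * F j).
    by rewrite [RHS]big_ord_recl sbin0 mul1r.
  by rewrite big_ord_recr /= sbin_small // mul0r addr0.
under [RHS]eq_bigr do rewrite mulrBr.
rewrite sumrB -shift big_ord_recl sbin0 mul1r -addrA -sumrB.
by congr (_ + _); apply: eq_bigr => j _; rewrite lift0 sbinS mulrBl.
Qed.

(** Each difference lowers the degree. *)
Lemma finite_diff N p x : (size p <= N)%N ->
  \sum_(j < N.+1) sbin N j * p.[x - j%:R] = 0.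
Proof.
elim: N p => [|N IHN] p sp.
  move: sp; rewrite leqn0 size_poly_eq0 => /eqP ->.
  by apply: big1 => j _; rewrite horner0 mulr0.
rewrite (sum_sbinS _ (fun j => p.[x - j%:R])) -[RHS](IHN _ (size_poly_diff sp)).
apply: eq_bigr => j _; congr (_ * _).
by rewrite hornerD hornerN horner_comp hornerXsubC -natr1 opprD addrA.
Qed.

(** The equation [t f' = - N t f / (1 - t)] for [f = (1 - t)^N], coefficientwise. *)
Lemma sum_sbin N l : N%:R * \sum_(a < l) sbin N a = - (sbin N l *+ l).
Proof.
elim: l => [|l IHl]; first by rewrite big_ord0 mulr0 mulr0n oppr0.
rewrite big_ord_recr mulrDr IHl /= /sbin exprS.
case: N {IHl} => [|N].
  by rewrite !bin0n; case: l => [|l] /=; rewrite !(mulr0n, mulr0, mul0r, mul0rn, oppr0, addr0).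
have e : l.+1%:R * 'C(N.+1, l.+1)%:R = (N.+1%:R - l%:R) * 'C(N.+1, l)%:R :> K.
  have [le|lt] := leqP l N.+1.
    by rewrite -natrB // -!natrM -mul_bin_left.
  by rewrite (bin_small lt) bin_small ?mulr0 // ltnS ltnW.
transitivity ((-1) ^+ l * (l.+1%:R * 'C(N.+1, l.+1)%:R) : K); last by ring.
by rewrite e; ring.
Qed.

End FiniteDifferences.

(** * The vertex operator on one copy of the polynomial ring *)

(** The properties of one sector that matter, for an arbitrary commutative algebra
    [A] in place of the polynomial ring. The [X k] generate [A]; [D k] is the
    derivation [h_(k+1)]; [E] and [sg] are the coefficients of the two exponentials,
    given by their recursions; [op] is the vertex operator. The number [N] is [2m],
    and [c] is its square root. *)
Record vertex_model (K : numFieldType) (A : comAlgType K) (N : nat) (c : K)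
    (X : nat -> A) (D : nat -> A -> A) (E : int -> A)
    (sg : nat -> A -> A) (op : int -> A -> A) : Prop := VertexModel {
  vm_c2 : c * c = N%:R;
  vm_ind : forall Q : A -> Prop,
    (forall a f g, Q f -> Q g -> Q (a *: f + g)) -> Q 1 ->
    (forall k f, Q f -> Q (X k * f)) -> forall f, Q f;
  vm_DL : forall k, linear (D k);
  vm_DM : forall k f g, D k (f * g) = D k f * g + f * D k g;
  vm_DX : forall k j, D k (X j) = (k.+1 * (j == k))%N%:R *: 1;
  vm_E_neg : forall n, n < 0 -> E n = 0;
  vm_E0 : E 0 = 1;
  vm_E_rec : forall n : nat,
    E n *+ n = c *: \sum_(k < n) X k * E (n%:Z - k.+1%:Z);
  vm_sgL : forall l, linear (sg l);
  vm_sgC : forall i j f, sg i (sg j f) = sg j (sg i f);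
  vm_sg0 : forall f, sg 0 f = f;
  vm_sg_rec : forall l f,
    sg l f *+ l = (- c) *: \sum_(k < l) D k (sg (l - k.+1)%N f);
  vm_sg_fin : forall f, exists L, forall l, (L <= l)%N -> sg l f = 0;
  vm_opL : forall j, linear (op j);
  vm_opE : forall j f L, (forall l, (L <= l)%N -> sg l f = 0) ->
    op j f = \sum_(l < L) E (l%:Z + j) * sg l f
}.

Section LinearFacts.
Variables (K : fieldType) (U V : lmodType K) (f : U -> V).
Hypothesis fL : linear f.

Lemma linD u v : f (u + v) = f u + f v.
Proof. by have := fL 1 u v; rewrite !scale1r. Qed.

Lemma lin0 : f 0 = 0.
Proof. by apply: (addIr (f 0)); rewrite -linD !add0r. Qed.

Lemma linZ c u : f (c *: u) = c *: f u.
Proof. by have := fL c u 0; rewrite lin0 !addr0. Qed.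

Lemma linB u v : f (u - v) = f u - f v.
Proof. by rewrite linD -scaleN1r linZ scaleN1r. Qed.

Lemma lin_sum (I : Type) (r : seq I) (P : pred I) (F : I -> U) :
  f (\sum_(i <- r | P i) F i) = \sum_(i <- r | P i) f (F i).
Proof. exact: (big_morph f linD lin0). Qed.

End LinearFacts.

Lemma sum_shift (V : zmodType) (F : int -> V) s B :
  (forall n, n < 0 -> F n = 0) -> (forall n, B%:Z - s%:Z <= n -> F n = 0) ->
  \sum_(a < B) F (a%:Z - s%:Z) = \sum_(a < B) F a.
Proof.
move=> Fneg Fbig; have [le|lt] := leqP s B; last first.
  by rewrite !big1 // => a _; [apply: Fbig|apply: Fneg]; have := ltn_ord a; lia.
move: Fbig; rewrite -(subnKC le); move: (B - s)%N => d Fbig.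
rewrite [RHS](@sum_ord_extend _ (s + d) d (fun a => F a)) ?leq_addl //; last first.
  by move=> l lel; apply: Fbig; lia.
rewrite big_split_ord /= big1 ?add0r; last first.
  by move=> a _; apply: Fneg; have := ltn_ord a; lia.
by apply: eq_bigr => a _; congr F; lia.
Qed.

Section VertexModel.
Variables (K : numFieldType) (A : comAlgType K) (N : nat) (c : K).
Variables (X : nat -> A) (D : nat -> A -> A) (E : int -> A).
Variables (sg : nat -> A -> A) (op : int -> A -> A).
Hypothesis V : vertex_model N c X D E sg op.

Let DL := vm_DL V.
Let sgL := vm_sgL V.
Let opL := vm_opL V.

Lemma mulrn_inj n (f g : A) : (0 < n)%N -> f *+ n = g *+ n -> f = g.
Proof.
move=> n0; rewrite -!scaler_nat => /(congr1 (fun u => n%:R^-1 *: u)).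
by rewrite !scalerA mulVf ?scale1r // pnatr_eq0 -lt0n.
Qed.

Lemma D1 k : D k 1 = 0.
Proof.
have := vm_DM V k 1 1; rewrite !mulr1 mul1r => /esym/eqP.
by rewrite -subr_eq0 addrK => /eqP.
Qed.

Lemma E_rec (r : int) B : r <= B%:Z ->
  r%:~R *: E r = c *: \sum_(k < B) X k * E (r - k.+1%:Z).
Proof.
case: r => [r|r] leB; last first.
  rewrite (vm_E_neg V) ?scaler0 // big1 ?scaler0 // => k _.
  by rewrite (vm_E_neg V) ?mulr0 //; lia.
rewrite -pmulrn scaler_nat (vm_E_rec V).
rewrite (@sum_ord_extend _ B r (fun k => X k * E (r%:Z - k.+1%:Z))) //.
by move=> k le; rewrite (vm_E_neg V) ?mulr0 //; lia.
Qed.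

Lemma sum_delta (F : nat -> A) k B : ((B <= k)%N -> F k = 0) ->
  \sum_(i < B) (k.+1 * (i == k :> nat))%N%:R *: F i = k.+1%:R *: F k.
Proof.
move=> Fk; have [lt|le] := ltnP k B; last first.
  rewrite (Fk le) scaler0 big1 // => i _.
  case: eqP => [ik|_]; last by rewrite muln0 scale0r.
  by have := ltn_ord i; rewrite ik ltnNge le.
rewrite (bigD1 (Ordinal lt)) //= eqxx muln1 big1 ?addr0 // => i.
by rewrite -val_eqE /= => /negbTE ->; rewrite muln0 scale0r.
Qed.

(** [h_k] multiplies the series [E(w)] by [c w^k], by induction along Newton's
    recursion. *)
Lemma D_E k n : D k (E n) = c *: E (n - k.+1%:Z).
Proof.
have [neg|] := ltrP n 0.
  by rewrite !(vm_E_neg V) ?scaler0 ?(lin0 (DL k)) //; lia.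
case: n => // n _; have [j] := ubnP n; elim: j n => // j IHj [|n] ltn.
  by rewrite (vm_E0 V) D1 (vm_E_neg V) ?scaler0 //; lia.
have IHn (i : 'I_n.+1) : D k (E (n.+1%:Z - i.+1%:Z))
    = c *: E (n.+1%:Z - k.+1%:Z - i.+1%:Z).
  have -> : n.+1%:Z - i.+1%:Z = (n - i)%N%:Z by have := ltn_ord i; lia.
  by rewrite IHj; [congr (_ *: E _); have := ltn_ord i; lia | lia].
apply: (@mulrn_inj n.+1) => //.
rewrite -scaler_nat -(linZ (DL k)) scaler_nat (vm_E_rec V) (linZ (DL k)).
rewrite (lin_sum (DL k)).
under eq_bigr => i _ do
  rewrite (vm_DM V) (vm_DX V) IHn -scalerAl mul1r -scalerAr.
rewrite big_split /= (sum_delta (F := fun i => E (n.+1%:Z - i.+1%:Z))); last first.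
  by move=> le; rewrite (vm_E_neg V) //; lia.
rewrite -scaler_sumr -(@E_rec (n.+1%:Z - k.+1%:Z) n.+1); last lia.
rewrite -scalerDl -scaler_nat !scalerA mulrC; congr (_ * _ *: _).
by rewrite intrB -!pmulrn; ring.
Qed.

(** Extending by zero to negative indices makes the recursions uniform. *)
Definition sigz (l : int) (f : A) : A := if l is Posz n then sg n f else 0.

Lemma sg_sgz (l : nat) f : sg l f = sigz l f.
Proof. by []. Qed.

Lemma sigz_linear l : linear (sigz l).
Proof.
by case: l => [l|l] a u v /=; [exact: sgL | rewrite scaler0 addr0].
Qed.

Lemma sigz_neg l f : l < 0 -> sigz l f = 0.
Proof. by case: l. Qed.

Lemma sigz_rec (r : int) B f : r <= B%:Z ->
  r%:~R *: sigz r f = (- c) *: \sum_(k < B) D k (sigz (r - k.+1%:Z) f).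
Proof.
have Dneg k l : l < 0 -> D k (sigz l f) = 0.
  by move=> /sigz_neg ->; rewrite (lin0 (DL k)).
case: r => [r|r] leB; last first.
  rewrite scaler0 big1 ?scaler0 // => k _.
  by rewrite Dneg //; lia.
rewrite -pmulrn scaler_nat (vm_sg_rec V).
rewrite (@sum_ord_extend _ B r (fun k => D k (sigz (r%:Z - k.+1%:Z) f))) //.
  congr (_ *: _); apply: eq_bigr => k _.
  by rewrite subzn.
by move=> k le; rewrite Dneg //; lia.
Qed.

Lemma DX i k : D i (X k) = (k.+1 * (i == k :> nat))%N%:R *: 1.
Proof. by rewrite (vm_DX V) eq_sym; case: eqP => [->|]; rewrite ?muln0. Qed.

(** The second exponential translates the variables: it sends [X k] to
    [X k - c z^(-k-1)]. *)
Lemma sigz_X l k g : sigz l (X k * g) = X k * sigz l g - c *: sigz (l - k.+1%:Z) g.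
Proof.
have [neg|] := ltrP l 0.
  by rewrite !sigz_neg ?scaler0 ?mulr0 ?subr0 //; lia.
case: l => // l _; have [j] := ubnP l; elim: j l => // j IHj [|l] ltl.
  by rewrite (@sigz_neg (_ - _)) /= ?(vm_sg0 V) ?scaler0 ?subr0 //; lia.
have IHl (i : 'I_l.+1) : sigz (l.+1%:Z - i.+1%:Z) (X k * g)
    = X k * sigz (l.+1%:Z - i.+1%:Z) g - c *: sigz (l.+1%:Z - k.+1%:Z - i.+1%:Z) g.
  have -> : l.+1%:Z - i.+1%:Z = (l - i)%N%:Z by have := ltn_ord i; lia.
  rewrite IHj; [congr (_ - _ *: sigz _ _); have := ltn_ord i; lia | lia].
apply: (@mulrn_inj l.+1) => //.
rewrite -scaler_nat pmulrn (@sigz_rec _ l.+1) //.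
under eq_bigr => i _ do
  rewrite IHl (linB (DL i)) (vm_DM V) DX (linZ (DL i)) -scalerAl mul1r.
rewrite sumrB big_split /= (sum_delta (F := fun i => sigz (l.+1%:Z - i.+1%:Z) g)); last first.
  by move=> le; rewrite sigz_neg //; lia.
rewrite -scaler_sumr -mulr_sumr scalerBr scalerDr.
rewrite [(- c) *: (X k * _)]scalerAr -sigz_rec //.
rewrite [(- c) *: (c *: _)]scalerA [- c * c]mulrC -[(c * - c) *: _]scalerA.
rewrite -(@sigz_rec _ l.+1); last lia.
rewrite mulrnBl -scalerAr -scaler_nat -[(c *: _) *+ _]scaler_nat -pmulrn.
rewrite [_ + l.+1%:R *: _]addrC -addrA; congr (_ + _).
rewrite !scalerA -scalerBl -scaleNr; congr (_ *: _).
by rewrite intrB -!pmulrn; ring.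
Qed.

Lemma sigz_1 l : sigz l 1 = if l == 0 then 1 else 0.
Proof.
case: l => // l; have [j] := ubnP l; elim: j l => // j IHj [|l] ltl /=.
  by rewrite (vm_sg0 V).
apply: (@mulrn_inj l.+1) => //; rewrite (vm_sg_rec V) mul0rn big1 ?scaler0 // => k _.
have := IHj (l.+1 - k.+1)%N; rewrite /= => -> //; last by have := ltn_ord k; lia.
by case: eqP => _; rewrite ?D1 ?(lin0 (DL k)).
Qed.

(** The second exponential is multiplicative, as the exponential of a derivation;
    it is enough to check this on the generators. *)
Lemma sigzM l B f g : l < B%:Z ->
  sigz l (f * g) = \sum_(a < B) sigz a f * sigz (l - a%:Z) g.
Proof.
elim/(vm_ind V): f l => [b u v IHu IHv|| k f IHf] l ltB.
- rewrite mulrDl -scalerAl sigz_linear IHu // IHv // scaler_sumr -big_split /=.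
  by apply: eq_bigr => a _; rewrite sgL mulrDl scalerAl.
- rewrite mul1r; case: B ltB => [|B] ltB.
    by rewrite big_ord0 sigz_neg.
  rewrite big_ord_recl /= (vm_sg0 V) mul1r subr0 big1 ?addr0 // => a _.
  by have := sigz_1 (lift ord0 a); rewrite /= => ->; rewrite mul0r.
rewrite -mulrA sigz_X IHf // IHf; last lia.
have := @sum_shift _ (fun n => sigz n f * sigz (l - k.+1%:Z - n) g) k.+1 B.
rewrite /= => <-; first last.
- by move=> n le; rewrite [sigz (_ - n) _]sigz_neg ?mulr0 //; lia.
- by move=> n neg; rewrite sigz_neg ?mul0r.
rewrite mulr_sumr scaler_sumr -sumrB; apply: eq_bigr => a _.
rewrite (sg_sgz a (X k * f)) sigz_X mulrBl -mulrA -scalerAl; congr (_ - _ *: (_ * sigz _ _)).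
by lia.
Qed.

(** The second exponential sends [E(w)] to [(1 - w/z)^N E(w)], since both sides
    satisfy the same recursion. *)
Lemma sigz_E l n : sigz l (E n) = (if l is Posz a then sbin K N a else 0) *: E (n - l).
Proof.
case: l => [l|l]; last by rewrite scale0r.
have [j] := ubnP l; elim: j l => // j IHj [|l] ltl.
  by rewrite /= (vm_sg0 V) sbin0 scale1r subr0.
apply: (@mulrn_inj l.+1) => //.
rewrite -scaler_nat pmulrn (@sigz_rec _ l.+1) //.
have step (k : 'I_l.+1) : D k (sigz (l.+1%:Z - k.+1%:Z) (E n))
    = (sbin K N (l - k) * c) *: E (n - l.+1%:Z).
  have lek : (k <= l)%N by rewrite -ltnS.
  have -> : l.+1%:Z - k.+1%:Z = (l - k)%N%:Z by lia.
  rewrite IHj; last lia.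
  by rewrite (linZ (DL k)) D_E scalerA; congr (_ *: E _); lia.
under eq_bigr => k _ do rewrite step.
rewrite -scaler_suml -mulr_suml scalerA -scaler_nat scalerA; congr (_ *: _).
have -> : \sum_(k < l.+1) sbin K N (l - k) = \sum_(a < l.+1) sbin K N a.
  by rewrite [RHS](reindex_inj rev_ord_inj); apply: eq_bigr.
rewrite mulNr mulrC -mulrA (vm_c2 V) mulrC sum_sbin opprK.
by rewrite mulr_natl.
Qed.

Lemma sigz_EM l n g :
  sigz l (E n * g) = \sum_(a < N.+1) sbin K N a *: (E (n - a%:Z) * sigz (l - a%:Z) g).
Proof.
have [neg|ge0] := ltrP l 0.
  rewrite sigz_neg // big1 // => a _.
  by rewrite sigz_neg ?mulr0 ?scaler0 //; lia.
rewrite (@sigzM _ (maxn `|l|.+1 N.+1)); last lia.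
rewrite -(@sum_ord_extend _ (maxn `|l|.+1 N.+1) N.+1
  (fun a => sbin K N a *: (E (n - a%:Z) * sigz (l - a%:Z) g))).
- by apply: eq_bigr => a _; rewrite sigz_E -scalerAl.
- exact: leq_maxr.
- by move=> a lta; rewrite sbin_small // scale0r.
Qed.

Lemma sigz_fin f : exists L : nat, forall l : int, L%:Z <= l -> sigz l f = 0.
Proof. by have [L HL] := vm_sg_fin V f; exists L; case. Qed.

Lemma opE j f L : (forall l : int, L%:Z <= l -> sigz l f = 0) ->
  op j f = \sum_(l < L) E (l%:Z + j) * sigz l f.
Proof.
by move=> HL; apply: (vm_opE V) => l le; have := HL l; rewrite /= => ->.
Qed.

(** The commutation of the vertex operator with [E(w)], up to [(1 - w/z)^N]. *)
Lemma op_EM j n g :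
  op j (E n * g) = \sum_(a < N.+1) sbin K N a *: (E (n - a%:Z) * op (j + a%:Z) g).
Proof.
have [L HL] := sigz_fin g.
have HLN (l : int) : (L + N)%N%:Z <= l -> sigz l g = 0 by move=> le; apply: HL; lia.
rewrite (@opE _ _ (L + N)); last first.
  move=> l le; rewrite sigz_EM big1 // => a _.
  by rewrite HL ?mulr0 ?scaler0 //; have := ltn_ord a; lia.
under eq_bigr do rewrite sigz_EM mulr_sumr.
rewrite exchange_big; apply: eq_bigr => a _ /=; rewrite (opE _ HLN).
have := @sum_shift _ (fun l => E (l + (j + a%:Z)) * sigz l g) a (L + N).
rewrite /= => <-; first last.
- by move=> l le; rewrite HL ?mulr0 //; have := ltn_ord a; lia.
- by move=> l neg; rewrite sigz_neg ?mulr0.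
rewrite mulr_sumr scaler_sumr; apply: eq_bigr => l _.
rewrite -scalerAr mulrCA; congr (_ *: (_ * (E _ * _))); lia.
Qed.

(** The coefficients of [(z - w)^N E(z) E(w)]. *)
Definition Ecomm (x y : int) : A :=
  \sum_(a < N.+1) sbin K N a *: (E (y - a%:Z) * E (x - N%:Z + a%:Z)).

Lemma op_op x y f L : (forall l : int, L%:Z <= l -> sigz l f = 0) ->
  op (x - N%:Z) (op y f) = \sum_(l < L) \sum_(k < L)
    Ecomm (k%:Z + x) (l%:Z + y) * sigz k (sigz l f).
Proof.
move=> HL; rewrite (opE y HL) (lin_sum (opL _)); apply: eq_bigr => l _.
rewrite op_EM.
have HLl (k : int) : L%:Z <= k -> sigz k (sigz l f) = 0.
  case: k => // k le; rewrite /= (vm_sgC V).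
  by have := HL k le; rewrite /= => ->; rewrite (lin0 (sgL l)).
under eq_bigr do rewrite (opE _ HLl) mulr_sumr scaler_sumr.
rewrite exchange_big; apply: eq_bigr => k _ /=.
rewrite mulr_suml; apply: eq_bigr => a _.
rewrite mulrA -scalerAl; congr (_ *: (_ * E _ * _)); lia.
Qed.

Lemma Ecomm_sym x y : (-1) ^+ N = 1 :> K -> Ecomm x y = Ecomm y x.
Proof.
move=> even; rewrite /Ecomm (reindex_inj rev_ord_inj); apply: eq_bigr => a _.
have lea : (a <= N)%N by rewrite -ltnS.
rewrite /= subSS mulrC; congr (_ *: (E _ * E _)); [|lia|lia].
rewrite /sbin bin_sub //; congr (_ * _).
apply: (mulIf (negbT (signr_eq0 K a))).
by rewrite -exprD subnK // even -expr2 sqrr_sign.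
Qed.

(** For even [N] the factor [(z - w)^N] is symmetric. *)
Lemma op_comm x y f : (-1) ^+ N = 1 :> K ->
  op (x - N%:Z) (op y f) = op (y - N%:Z) (op x f).
Proof.
move=> even; have [L HL] := sigz_fin f.
rewrite !(op_op _ _ HL) exchange_big; apply: eq_bigr => k _; apply: eq_bigr => l _ /=.
by rewrite Ecomm_sym // (vm_sgC V).
Qed.

Lemma op_1 y : op y 1 = E y.
Proof.
rewrite (@opE _ _ 1); first by rewrite big_ord1 add0r /= (vm_sg0 V) mulr1.
by move=> l le; rewrite sigz_1; case: eqP le => // ->.
Qed.

(** The product of two vertex operators contains [(z - w)^N]. Pairing its part of
    degree [s] with a polynomial [p] in the exponent of [z] thus amounts to pairing
    a series without this factor with the [N]-th difference of [p]. *)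
Lemma op_relation (p : {poly K}) (s : nat) : (size p <= N)%N ->
  \sum_(a < s.+1) p.[a%:R] *: op (a%:Z - N%:Z) (op (s%:Z - a%:Z) 1) = 0.
Proof.
move=> sp; pose F (n : int) := E (s%:Z - N%:Z - n) * E n.
transitivity (\sum_(j < N.+1) \sum_(a < s.+1)
    (sbin K N j * p.[(a%:Z - (N - j)%N%:Z)%:~R + (N - j)%N%:R])
       *: F (a%:Z - (N - j)%N%:Z)).
  rewrite exchange_big; apply: eq_bigr => a _ /=.
  (* op_EM needs a product, here with the factor 1 on which op is known *)
  rewrite op_1 -[E (_ - _)]mulr1 op_EM scaler_sumr; apply: eq_bigr => j _.
  have lej : (j <= N)%N by rewrite -ltnS.
  rewrite op_1 scalerA mulrC intrB -!pmulrn subrK /F.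
  by congr (_ *: (E _ * E _)); lia.
rewrite (eq_bigr (fun j : 'I_N.+1 => \sum_(n < s.+1)
  (sbin K N j * p.[n%:R + N%:R - j%:R]) *: F n%:Z)).
  rewrite exchange_big big1 // => n _ /=.
  by rewrite -scaler_suml finite_diff ?scale0r.
move=> j _; have lej : (j <= N)%N by rewrite -ltnS.
rewrite (@sum_shift _ (fun n => (sbin K N j * p.[n%:~R + (N - j)%N%:R]) *: F n)).
- by apply: eq_bigr => n _; rewrite -pmulrn natrB // addrA.
- by move=> n neg; rewrite /F [E n](vm_E_neg V) ?mulr0 ?scaler0.
- by move=> n le; rewrite /F (vm_E_neg V) ?mul0r ?scaler0 //; lia.
Qed.

End VertexModel.

(** * Linear spans of families of vectors *)

Section LinearSpan.
Variable K : fieldType.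

Inductive lspan (V : lmodType K) (T : Type) (e : T -> V) (Q : T -> Prop) :
    V -> Prop :=
  | lspan0 : lspan e Q 0
  | lspan_cons c t f : Q t -> lspan e Q f -> lspan e Q (c *: e t + f).

Section Closure.
Variables (V : lmodType K) (T : Type) (e : T -> V) (Q : T -> Prop).

Lemma lspanD f g : lspan e Q f -> lspan e Q g -> lspan e Q (f + g).
Proof.
elim=> [|c t u Qt _ IHu] Hg; first by rewrite add0r.
by rewrite -addrA; apply: lspan_cons => //; apply: IHu.
Qed.

Lemma lspanZ c f : lspan e Q f -> lspan e Q (c *: f).
Proof.
elim=> [|d t u Qt _ IHu]; first by rewrite scaler0; apply: lspan0.
by rewrite scalerDr scalerA; apply: lspan_cons.
Qed.

Lemma lspan_gen t : Q t -> lspan e Q (e t).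
Proof.
by move=> Qt; rewrite -[e t]addr0 -[e t]scale1r; apply: lspan_cons => //; apply: lspan0.
Qed.

Lemma lspan_sum (I : Type) (r : seq I) (P : pred I) (F : I -> V) :
  (forall i, P i -> lspan e Q (F i)) -> lspan e Q (\sum_(i <- r | P i) F i).
Proof.
move=> HF; apply: big_rec => [|i f Pi Hf]; first exact: lspan0.
by apply: lspanD => //; apply: HF.
Qed.

End Closure.

Lemma lspan_linear (U V : lmodType K) (T T' : Type) (e : T -> U) (e' : T' -> V)
    (Q : T -> Prop) (Q' : T' -> Prop) (f : U -> V) u :
  linear f -> (forall t, Q t -> lspan e' Q' (f (e t))) ->
  lspan e Q u -> lspan e' Q' (f u).
Proof.
move=> fL Hf; elim=> [|c t v Qt _ IHv]; first by rewrite lin0 //; apply: lspan0.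
by rewrite fL; apply: lspanD => //; apply: lspanZ; apply: Hf.
Qed.

Lemma lspan_sub (V : lmodType K) (T : Type) (e : T -> V) (Q Q' : T -> Prop) u :
  (forall t, Q t -> Q' t) -> lspan e Q u -> lspan e Q' u.
Proof.
move=> QQ'; elim=> [|c t v Qt _ IHv]; first exact: lspan0.
by apply: lspan_cons => //; apply: QQ'.
Qed.

Lemma lspan_uniq (V : lmodType K) (T : eqType) (e : T -> V)
    (Q : pred T) f : lspan e Q f ->
  exists r : seq T, exists d : T -> K,
    [/\ uniq r, all Q r & f = \sum_(t <- r) d t *: e t].
Proof.
elim=> [|c t g Qt _ [r [d [ur Qr ->]]]].
  by exists [::], (fun=> 0); rewrite big_nil.
have [tr|tr] := boolP (t \in r).
  exists r, (fun t' => if t' == t then c + d t else d t'); split=> //.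
  rewrite !(bigD1_seq t) //= eqxx scalerDl -addrA; congr (_ + (_ + _)).
  by apply: eq_bigr => t' /negbTE ->.
exists (t :: r), (fun t' => if t' == t then c else d t'); split.
- by rewrite /= tr.
- by rewrite /= Qt.
rewrite big_cons eqxx; congr (_ + _); apply: eq_big_seq => t' t'r.
by case: eqP tr => // <-; rewrite t'r.
Qed.

End LinearSpan.

(** * Triangularity *)

(** The index lists of the terms of [sg l (E n_1 ... E n_k)]. *)
Fixpoint low (l : int) (ns ns' : seq int) : bool :=
  match ns, ns' with
  | [::], [::] => l == 0
  | n :: ns, n' :: ns' => (n' <= n) && low (l - (n - n')) ns ns'
  | _, _ => false
  end.

(** For [s = 0] this is the dominance order between lists with the same length and
    the same sum, without any requirement that they be sorted. The slack [s] is the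
    excess of the initial sums of [ns] accumulated so far. *)
Fixpoint dom (s : int) (mu ns : seq int) : bool :=
  match mu, ns with
  | [::], [::] => s == 0
  | u :: mu, n :: ns => (0 <= s + n - u) && dom (s + n - u) mu ns
  | _, _ => false
  end.

Definition sumsq (ns : seq int) : int := \sum_(n <- ns) n ^+ 2.

Lemma low_ge0 l ns ns' : low l ns ns' -> 0 <= l.
Proof.
elim: ns ns' l => [|n ns IHns] [|n' ns'] l //=; first by move=> /eqP ->.
by move=> /andP[le /IHns]; lia.
Qed.

Lemma dom_refl mu : dom 0 mu mu.
Proof. by elim: mu => //= u mu; rewrite add0r subrr. Qed.

(** Lowering entries by a total of [l] preserves dominance if [l] is given to an
    entry in front of them: this is what a new vertex operator does. *)
Lemma dom_low s l mu ns ns' : 0 <= s -> dom s mu ns -> low l ns ns' -> dom (s + l) mu ns'.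
Proof.
elim: mu ns ns' s l => [|u mu IHmu] [|n ns] [|n' ns'] s l //= s0.
  by move=> /eqP -> /eqP ->.
move=> /andP[ge0 Hd] /andP[le Hl]; have := low_ge0 Hl => l0.
have -> : s + l + n' - u = s + n - u + (l - (n - n')) by lia.
by rewrite (IHmu _ _ _ _ ge0 Hd Hl) andbT; lia.
Qed.

Lemma dom_size s mu ns : dom s mu ns -> size ns = size mu.
Proof. by elim: mu ns s => [|u mu IHmu] [|n ns] s //= /andP[_ /IHmu ->]. Qed.

(** With [d = ns - mu], the sum of the squares grows by
    [sum d_r^2 + 2 sum mu_r d_r]. The last sum is nonnegative for [s = 0] by
    summation by parts, as [mu] decreases and the initial sums of [d] are
    nonnegative. *)
Lemma dom_sumsq s h mu ns : 0 <= s -> path >=%R h mu -> dom s mu ns ->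
  sumsq mu + (ns != mu)%:Z <= sumsq ns + 2%:Z * s * h.
Proof.
rewrite /sumsq; elim: mu ns s h => [|u mu IHmu] [|n ns] s h //= s0.
  by move=> _ /eqP ->; rewrite !big_nil mulr0 mul0r.
move=> /andP[uh pmu] /andP[ge0 Hd]; have := IHmu _ _ _ ge0 pmu Hd.
rewrite !big_cons eqseq_cons; move: (\sum_(i <- mu) _) (\sum_(i <- ns) _) => a b.
have [->|nu] := eqVneq n u; case: (ns != mu) => /=; nia.
Qed.

Section Triangular.
Variables (K : numFieldType) (A : comAlgType K) (N : nat) (c : K).
Variables (X : nat -> A) (D : nat -> A -> A) (E : int -> A).
Variables (sg : nat -> A -> A) (op : int -> A -> A).
Hypothesis V : vertex_model N c X D E sg op.

Local Notation sigz := (@sigz K A sg).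

Definition eprod (ns : seq int) : A := \prod_(n <- ns) E n.

Lemma eprod_nil : eprod [::] = 1.
Proof. exact: big_nil. Qed.

Lemma eprod_cons n ns : eprod (n :: ns) = E n * eprod ns.
Proof. exact: big_cons. Qed.

Lemma mulr_linear (f : A) : linear ( *%R f).
Proof. by move=> a u v; rewrite mulrDr scalerAr. Qed.

Lemma sigz_eprod l ns : lspan eprod (low l ns) (sigz l (eprod ns)).
Proof.
elim: ns l => [|n ns IHns] l.
  rewrite eprod_nil (sigz_1 V); case: eqP => [->|_]; last exact: lspan0.
  by rewrite -eprod_nil; apply: lspan_gen.
rewrite eprod_cons (sigz_EM V); apply: lspan_sum => a _; apply: lspanZ.
apply: lspan_linear (mulr_linear _) _ (IHns _) => ns' Hns'.
rewrite -eprod_cons; apply: lspan_gen => /=.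
have -> : l - (n - (n - a%:Z)) = l - a%:Z by lia.
by rewrite Hns' andbT; lia.
Qed.

Lemma op_eprod j ns :
  lspan eprod (fun ms => exists l ns', [/\ 0 < l, low l ns ns' & ms = (j + l) :: ns'])
    (op j (eprod ns) - E j * eprod ns).
Proof.
have [L HL] := sigz_fin V (eprod ns).
rewrite (@opE _ _ _ _ _ _ _ _ _ V _ _ L.+1); last by move=> l le; apply: HL; lia.
rewrite big_ord_recl add0r /= (vm_sg0 V) addrC addKr.
apply: lspan_sum => l _.
rewrite (sg_sgz sg _ (eprod ns)).
apply: lspan_linear (mulr_linear _) _ (sigz_eprod _ _) => ns' Hns'.
rewrite -eprod_cons; apply: lspan_gen.
by exists (lift ord0 l)%:Z, ns'; split=> //; rewrite addrC.
Qed.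

(** When the mode of index [i] acts after [k] others, its sector shifts the index
    of [op] by [N k]. *)
Fixpoint vecs (js : seq nat) : A :=
  if js is i :: js' then op (i%:Z - (N * size js')%N%:Z) (vecs js') else 1.

Fixpoint lead (js : seq nat) : seq int :=
  if js is i :: js' then (i%:Z - (N * size js')%N%:Z) :: lead js' else [::].

Lemma size_lead js : size (lead js) = size js.
Proof. by elim: js => //= i js ->. Qed.

(** The new operator puts its index in front and moves some weight [l] to it from
    the other entries; for [l = 0] nothing moves, which gives the leading term. *)
Lemma vecs_triangular js :
  lspan eprod (fun ns => dom 0 (lead js) ns && (ns != lead js))
    (vecs js - eprod (lead js)).
Proof.
elim: js => [|i js IHjs]; first by rewrite /= eprod_nil subrr; apply: lspan0.
pose j := i%:Z - (N * size js)%N%:Z; pose mu := lead js.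
pose Q ns := dom 0 (j :: mu) ns && (ns != j :: mu).
change (lspan eprod Q (op j (vecs js) - eprod (j :: mu))).
have opQ ns : dom 0 mu ns -> lspan eprod Q (op j (eprod ns) - E j * eprod ns).
  move=> Hns; apply: lspan_sub (op_eprod j ns) => _ [l [ns' [l0 Hl ->]]].
  rewrite /Q /= add0r addrC addKr eqseq_cons.
  have := dom_low (lexx 0) Hns Hl; rewrite add0r => ->.
  by rewrite (ltW l0) /= negb_and; apply/orP; left; lia.
rewrite -[vecs js](subrK (eprod mu)) (linD (vm_opL V j)) eprod_cons -addrA.
apply: lspanD (opQ _ (dom_refl _)).
apply: lspan_linear (vm_opL V j) _ IHjs => ns /andP[Hd Hn].
rewrite -[op j _](subrK (E j * eprod ns)); apply: lspanD (opQ _ Hd) _.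
rewrite -eprod_cons; apply: lspan_gen.
by rewrite /Q /= add0r subrr lexx eqseq_cons eqxx Hd.
Qed.

End Triangular.

(** * Algebraic independence of the coefficients of the exponential *)

Lemma strong_recursion (T : Type) (x0 : T) (F : nat -> (nat -> T) -> T) :
  (forall n f g, (forall k, (k < n)%N -> f k = g k) -> F n f = F n g) ->
  exists t, forall n, t n = F n t.
Proof.
move=> Fext.
pose vals := fix vals n := if n is n'.+1 then rcons (vals n') (F n' (nth x0 (vals n')))
                           else [::].
have size_vals n : size (vals n) = n by elim: n => //= n IHn; rewrite size_rcons IHn.
pose t k := nth x0 (vals k.+1) k.
have valsE n k : (k < n)%N -> nth x0 (vals n) k = t k.
  elim: n => // n IHn; rewrite ltnS leq_eqVlt => /orP[/eqP -> //|lt].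
  by rewrite /= nth_rcons size_vals lt IHn.
exists t => n; rewrite {1}/t /= nth_rcons size_vals ltnn eqxx.
by apply: Fext => k; apply: valsE.
Qed.

(** Newton's recursion, solved for the power sums [t]: the [n]-th equation involves
    [t (n - 1)] with coefficient [c * y 0 = c]. *)
Lemma newton_solve (K : fieldType) (B : comAlgType K) (c : K) (y : nat -> B) :
  c != 0 -> y 0%N = 1 ->
  exists t : nat -> B,
    forall n, y n *+ n = c *: \sum_(k < n) t k * y (n - k.+1)%N.
Proof.
move=> c0 y0.
pose F n (f : nat -> B) := c^-1 *: (y n.+1 *+ n.+1) - \sum_(k < n) f k * y (n - k)%N.
have [n f g fg|t tE] := @strong_recursion _ 0 F.
  by congr (_ - _); apply: eq_bigr => k _; rewrite fg.
exists t => -[|n]; first by rewrite big_ord0 scaler0.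
rewrite big_ord_recr /= subnn y0 mulr1 [t n]tE addrC.
by rewrite /F subrK scalerA divff // scale1r.
Qed.

(** Both series satisfy Newton's recursion with the power sums [t]. *)
Lemma newton_unique (K : numFieldType) (A B : comAlgType K) (N : nat) (c : K)
    (X : nat -> A) D E sg op (y t : nat -> B) (tau : A -> B) :
  vertex_model N c X D E sg op -> linear tau -> tau 1 = 1 ->
  (forall f g, tau (f * g) = tau f * tau g) -> (forall k, tau (X k) = t k) ->
  y 0%N = 1 -> (forall n, y n *+ n = c *: \sum_(k < n) t k * y (n - k.+1)%N) ->
  forall n : nat, tau (E n) = y n.
Proof.
move=> V tauL tau1 tauM tauX y0 ty n.
have [j] := ubnP n; elim: j n => // j IHj [|n] ltn.
  by rewrite (vm_E0 V) tau1 y0.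
apply: (@mulrn_inj _ _ n.+1) => //.
rewrite -scaler_nat -(linZ tauL) scaler_nat (vm_E_rec V) (linZ tauL) (lin_sum tauL).
rewrite ty; congr (_ *: _); apply: eq_bigr => k _.
have lek : (k <= n)%N by rewrite -ltnS.
by rewrite tauM tauX subzn // IHj // subSS; lia.
Qed.

Section Leading.
Variables (K : numFieldType) (N : nat) (c : K).
Local Notation S := (polyN K).
Variables (D : nat -> S -> S) (E : int -> S) (sg : nat -> S -> S) (op : int -> S -> S).
Hypothesis V : vertex_model N c (fun k => mon K (ucm (k%N : nat))) D E sg op.
Hypothesis c0 : c != 0.

(** The universal series with constant term [1]. *)
Definition evar (n : int) : S :=
  if n is Posz n' then (if n' is k.+1 then mon K (ucm k) else 1) else 0.

(** The monomial of a product of coefficients of the universal series; an entry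
    [0] contributes the constant term. *)
Fixpoint emono (ns : seq int) : {cmonom nat} :=
  match ns with
  | Posz k.+1 :: ns => mulcm (ucm k) (emono ns)
  | _ :: ns => emono ns
  | [::] => mone
  end.

(** The coefficients of [E] are algebraically independent: solving Newton's
    recursion for the power sums specializes [E] to the universal series. *)
Lemma universal_specialization :
  exists tau : S -> S, [/\ linear tau, tau 1 = 1,
    forall f g, tau (f * g) = tau f * tau g & forall n, tau (E n) = evar n].
Proof.
have [t tE] := @newton_solve _ _ c (fun n : nat => evar n) c0 erefl.
exists (peval t); split; first by move=> a u v; rewrite peval_lin.
- exact: peval1.
- by move=> f g; apply: pevalM.
case=> [n|n]; last first.
  by rewrite (vm_E_neg V) //; apply: lin0 => a u v; rewrite peval_lin.
have tauL : linear (peval t) by move=> a u v; rewrite peval_lin.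
have tauX k : peval t (mon K (ucm (k%N : nat))) = t k by rewrite pevalX.
exact: (@newton_unique K S S N c _ D E sg op (fun n : nat => evar n) t (peval t)
  V tauL (peval1 t) (pevalM t) tauX erefl tE n).
Qed.

Lemma emono_count ns k : emono ns k = count_mem k.+1%:Z ns.
Proof.
elim: ns => [|[[|n]|n] ns IHns] /=; rewrite ?cm1 //.
by rewrite mulcmE ucmE IHns.
Qed.

(** The zeros, which the monomial does not see, are counted by the length. *)
Lemma emono_perm ns ms : size ns = size ms ->
  all (fun n => 0 <= n) ns -> all (fun n => 0 <= n) ms ->
  emono ns = emono ms -> perm_eq ns ms.
Proof.
move=> eqs ns0 ms0 eqm.
have cnt z : z != 0 -> count_mem z ns = count_mem z ms.
  case: z => [[|z]|z] // _; first by rewrite -!emono_count eqm.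
  have noneg (s : seq int) : all (fun n => 0 <= n) s -> count_mem (Negz z) s = 0%N.
    by move=> /allP s0; apply/count_memPn/negP => /s0.
  by rewrite !noneg.
apply/allP => z _; apply/eqP; have [->|/cnt //] := eqVneq z 0.
have eC : count (predC (pred1 0)) ns = count (predC (pred1 0)) ms.
  rewrite -!size_filter; apply: perm_size; apply/allP => z' _; apply/eqP.
  rewrite !count_filter; have [->|nz] := eqVneq z' 0.
    by rewrite !(@eq_count _ _ pred0) ?count_pred0 // => i /=; case: eqP.
  rewrite -[LHS](@eq_count _ (pred1 z')) -?[RHS](@eq_count _ (pred1 z')) ?cnt //;
    by move=> i /=; case: eqP => //= ->; rewrite nz.
apply: (@addIn (count (predC (pred1 0)) ms)).
by rewrite count_predC -eC count_predC.
Qed.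

Lemma sumsq_perm ns ms : perm_eq ns ms -> sumsq ns = sumsq ms.
Proof. exact: perm_big. Qed.

Definition spread (js : seq nat) : bool := sorted (fun a b => b + N <= a)%N js.

(** The gaps of a spread list absorb the shifts by the multiples of [N]. *)
Lemma lead_spread js : spread js ->
  all (fun n => 0 <= n) (lead N js) /\ sorted >=%R (lead N js).
Proof.
elim: js => // i [|j js] IHjs.
  by rewrite /= muln0 subr0.
move=> /andP[le /IHjs [/= /andP[j0 js0] ps]].
have le' : j%:Z - (N * size js)%N%:Z <= i%:Z - (N * (size js).+1)%N%:Z.
  by rewrite mulnS; lia.
by rewrite js0 j0 le' ps (le_trans j0 le').
Qed.

Lemma lead_inj js js' : lead N js = lead N js' -> js = js'.
Proof.
elim: js js' => [|i js IHjs] [|i' js'] //= [ei /[dup] /(congr1 size)].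
rewrite !size_lead => es /IHjs ejs; rewrite ejs in ei *.
by congr (_ :: _); lia.
Qed.

Lemma perm_lead js js' : spread js -> spread js' ->
  perm_eq (lead N js) (lead N js') = (js == js').
Proof.
move=> /lead_spread[_ s] /lead_spread[_ s'].
apply/idP/eqP => [p|->]; last exact: perm_refl.
apply/lead_inj/(sorted_eq _ _ s s' p).
- by move=> x y z /= h1 h2; apply: le_trans h2 h1.
- by move=> x y /= /andP[h1 h2]; apply/eqP; rewrite eq_le h1 h2.
Qed.

(** The exponents of [vecs js] other than its leading one have a larger sum of
    squares, so that the leading exponents separate these vectors. *)
Lemma leading_coefficients :
  exists tau : S -> S, linear tau /\
    forall js js', spread js -> spread js' -> size js = size js' ->
      sumsq (lead N js) <= sumsq (lead N js') ->
      (tau (vecs N op js'))@_(emono (lead N js)) = (js == js')%:R.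
Proof.
have [tau [tauL tau1 tauM tauE]] := universal_specialization.
exists tau; split=> // js js' sjs sjs' eqs le.
have [js0 _] := lead_spread sjs; have [js0' sl'] := lead_spread sjs'.
have tau_eprod ns : tau (eprod E ns)
    = if all (fun n => 0 <= n) ns then mon K (emono ns) else 0.
  elim: ns => [|n ns IHns]; first by rewrite eprod_nil tau1 -mon1.
  rewrite eprod_cons tauM tauE IHns /=.
  case: n => [[|n]|n] /=; last by rewrite mul0r.
  - by rewrite mul1r.
  - by case: ifP => _; rewrite ?mulr0 // monM.
have small ns : dom 0 (lead N js') ns && (ns != lead N js') ->
    (tau (eprod E ns))@_(emono (lead N js)) = 0.
  move=> /andP[Hd ne]; rewrite tau_eprod.
  case: ifP => [ns0|_]; last exact: mcoeff0.
  rewrite mcoeff_mon; case: eqP => // em.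
  have sz : size ns = size (lead N js) by rewrite (dom_size Hd) !size_lead.
  have /sumsq_perm eq := emono_perm sz ns0 js0 em.
  have pth : path >=%R (head 0 (lead N js')) (lead N js').
    by case: (lead N js') sl' => //= u mu ->; rewrite lexx.
  by have := dom_sumsq (lexx 0) pth Hd; move: le; rewrite -eq ne; clear; lia.
rewrite -[vecs N op js'](subrK (eprod E (lead N js'))) (linD tauL) mcoeffD.
have -> : (tau (vecs N op js' - eprod E (lead N js')))@_(emono (lead N js)) = 0.
  elim: (vecs_triangular V js') => [|d ns f Hns _ IHf].
    by rewrite (lin0 tauL) mcoeff0.
  by rewrite tauL mcoeffD mcoeffZ (small _ Hns) IHf mulr0 addr0.
have e : (emono (lead N js') == emono (lead N js)) = (js == js').
  apply/eqP/eqP => [em|-> //]; apply/eqP; rewrite -perm_lead // perm_sym.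
  by apply: emono_perm; rewrite // !size_lead.
by rewrite add0r tau_eprod js0' mcoeff_mon e.
Qed.

(** By induction on the sum of squares of the leading index list: the terms with a
    smaller sum have been shown to be absent, and those with a larger or equal one
    do not contain the leading monomial in question. *)
Lemma vecs_free (r : seq (seq nat)) (d : seq nat -> K) :
  uniq r -> all spread r ->
  (forall k, \sum_(js <- r | size js == k) d js *: vecs N op js = 0) ->
  forall js, js \in r -> d js = 0.
Proof.
move=> ur /allP sr d0 js jsr.
have [tau [tauL tauE]] := leading_coefficients.
have [n] := ubnP `|sumsq (lead N js)|%N; elim: n js jsr => // n IHn js jsr ltn.
have sq0 ns : 0 <= sumsq ns by apply: sumr_ge0 => i _; apply: sqr_ge0.
have term js' : js' \in r -> size js' = size js ->
    (tau (d js' *: vecs N op js'))@_(emono (lead N js)) = (js' == js)%:R * d js.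
  move=> jsr' eqs; rewrite (linZ tauL) mcoeffZ.
  have [le|lt] := lerP (sumsq (lead N js)) (sumsq (lead N js')).
    rewrite (tauE js js' (sr _ jsr) (sr _ jsr') (esym eqs) le) eq_sym.
    by case: eqP => [->|_]; rewrite ?mulr1 ?mul1r ?mulr0 ?mul0r.
  have nj : js' != js by apply: contraTneq lt => ->; rewrite ltxx.
  rewrite (negbTE nj) mul0r IHn ?mul0r //.
  by have := sq0 (lead N js'); lia.
transitivity (\sum_(js' <- r | size js' == size js) (js' == js)%:R * d js).
  rewrite -big_filter (bigD1_seq js) ?filter_uniq ?mem_filter ?eqxx ?jsr //.
  by rewrite /= mul1r big1 ?addr0 // => js' /negbTE ->; rewrite mul0r.
transitivity ((tau (\sum_(js' <- r | size js' == size js) d js' *: vecs N op js'))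
    @_(emono (lead N js))).
  rewrite (lin_sum tauL) raddf_sum [LHS]big_seq_cond [RHS]big_seq_cond.
  by apply: eq_bigr => js' /andP[jsr' /eqP eqs]; rewrite [RHS]term.
by rewrite d0 (lin0 tauL) mcoeff0.
Qed.

End Leading.

(** * Reduction to spread monomials modulo the quadratic relations *)

Section Reduction.
Variables (K : numFieldType) (A : comAlgType K) (m : nat) (x : nat -> A).
Variable I : A -> Prop.
Hypothesis I0 : I 0.
Hypothesis ID : forall f g, I f -> I g -> I (f + g).
Hypothesis IM : forall f g, I g -> I (f * g).
Hypothesis Irel : forall (s : nat) (i : 'I_m),
  I (\sum_(a < s.+1) (a ^_ i * (s - a) ^_ i)%N%:R *: (x a * x (s - a)%N)).

Lemma ideal_scale c f : I f -> I (c *: f).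
Proof. by move=> If; rewrite -[f]mul1r scalerAl; apply: IM. Qed.

Definition quad (q : {poly K}) (s : nat) : A :=
  \sum_(a < s.+1) q.[(a * (s - a))%N%:R] *: (x a * x (s - a)%N).

Lemma quad_lin c (p q : {poly K}) s : quad (c *: p + q) s = c *: quad p s + quad q s.
Proof.
rewrite /quad scaler_sumr -big_split; apply: eq_bigr => a _ /=.
by rewrite hornerD hornerZ scalerDl scalerA.
Qed.

(** The weight in the quadratic relation of order [i], as a polynomial in
    [u = a (s - a)]: use [(a - j) (s - a - j) = u - (j s - j^2)]. *)
Fixpoint ffact_poly (s i : nat) : {poly K} :=
  if i is j.+1 then ffact_poly s j * ('X - (j%:R * s%:R - j%:R ^+ 2)%:P) else 1.

Lemma ffact_poly_monic s i : ffact_poly s i \is monic.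
Proof.
elim: i => [|i IHi] /=; first exact: monic1.
by rewrite monicMl // monicXsubC.
Qed.

Lemma size_ffact_poly s i : size (ffact_poly s i) = i.+1.
Proof.
elim: i => [|i IHi] /=; first exact: size_poly1.
by rewrite size_Mmonic ?monicXsubC ?monic_neq0 ?ffact_poly_monic //
  IHi size_XsubC addn2.
Qed.

Lemma ffact_polyE s i a : (a <= s)%N ->
  (ffact_poly s i).[(a * (s - a))%N%:R] = (a ^_ i * (s - a) ^_ i)%N%:R.
Proof.
move=> le; elim: i => [|i IHi] /=; first by rewrite hornerC.
rewrite hornerM IHi hornerXsubC !ffactnSr.
have [lt|ge] := ltnP a i; first by rewrite ffact_small // !mul0n mul0r.
have [lt|ge'] := ltnP (s - a) i; first by rewrite [(s - a) ^_ i]ffact_small // !(mul0n, muln0) mul0r.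
rewrite !natrM !natrB //; ring.
Qed.

(** These polynomials are monic of degrees [0, ..., m - 1], so they span all the
    polynomials of degree less than [m]. *)
Lemma quad_ideal (q : {poly K}) s : (size q <= m)%N -> I (quad q s).
Proof.
have [j] := ubnP (size q); elim: j q => // j IHj q ltj lem.
have [->|q0] := eqVneq q 0.
  rewrite /quad big1 // => a _; by rewrite horner0 scale0r.
have sq : (0 < size q)%N by rewrite size_poly_gt0.
pose i := (size q).-1; have sqE : size q = i.+1 by rewrite /i prednK.
have im : (i < m)%N by rewrite -sqE.
pose p := q - lead_coef q *: ffact_poly s i.
have -> : q = lead_coef q *: ffact_poly s i + p by rewrite addrC subrK.
have sp : (size p <= i)%N.
  apply/leq_sizeP => k lek; rewrite coefB coefZ.
  have [ki|nki] := eqVneq k i.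
    have /monicP := ffact_poly_monic s i; rewrite lead_coefE size_ffact_poly /=.
    by rewrite ki lead_coefE -/i => ->; rewrite mulr1 subrr.
  by rewrite !nth_default ?mulr0 ?subrr // ?size_ffact_poly ?sqE; lia.
rewrite quad_lin; apply: ID; last by apply: IHj; lia.
apply: ideal_scale; have := Irel s (Ordinal im); rewrite /quad /=.
congr (I _); apply: eq_bigr => a _.
by rewrite ffact_polyE // -ltnS.
Qed.

(** Interpolating at all the close pairs but one expresses the product of a close
    pair through products of more distant pairs with the same sum. *)
Lemma close_pair a b : (b <= a)%N -> (a < b + 2 * m)%N ->
  exists r : A, I (x a * x b - r) /\
    lspan (fun t : nat * nat => x t.1 * x t.2)
      (fun t => (t.1 + t.2 = a + b)%N /\ (a ^ 2 + b ^ 2 < t.1 ^ 2 + t.2 ^ 2)%N) r.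
Proof.
move=> leba close; set Q := fun t : nat * nat => _.
pose s := (a + b)%N.
have [h [h' [sE hh']]] : exists h h', s = (h + h')%N /\ (h <= h' <= h.+1)%N.
  by exists s./2, (s - s./2)%N; lia.
(* the pairs with sum s are (h - t, h' + t), and they are close for t < m *)
have [t0 [t0h t0m aE bE]] : exists t0,
    [/\ t0 <= h, t0 < m, a = h' + t0 & b = h - t0]%N.
  by exists (h - b)%N; split; move: sE; rewrite /s; lia.
pose u (t : nat) : K := (h%:R - t%:R) * (h'%:R + t%:R).
pose ts := rem t0 (iota 0 m).
have tsE t : (t \in ts) = (t != t0) && (t < m)%N.
  by rewrite mem_rem_uniq ?iota_uniq // !inE mem_iota.
pose q := \prod_(t <- ts) ('X - (u t)%:P).
have sq : (size q <= m)%N.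
  rewrite size_prod_XsubC size_rem ?mem_iota // size_iota.
  by rewrite prednK // (leq_ltn_trans _ t0m).
have qE y : q.[y] = \prod_(t <- ts) (y - u t).
  by rewrite horner_prod; apply: eq_bigr => t _; rewrite hornerXsubC.
have uE t : (t <= h)%N -> ((h - t) * (h' + t))%N%:R = u t.
  by move=> le; rewrite natrM natrB // natrD.
have q_close t : (t <= h)%N -> (t < m)%N -> t != t0 ->
    q.[((h - t) * (h' + t))%N%:R] = 0.
  move=> le lt nt; apply/eqP; rewrite qE uE // prodf_seq_eq0.
  by apply/hasP; exists t; rewrite ?tsE ?nt //= subrr.
have q_pair : q.[(b * a)%N%:R] != 0.
  rewrite qE bE aE uE // prodf_seq_neq0; apply/allP => t; rewrite tsE => /andP[nt _] /=.
  have -> : u t0 - u t = (t%:R - t0%:R) * (t + t0 + (h' - h))%N%:R.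
    rewrite !natrD natrB; last by case/andP: hh'.
    by rewrite /u; ring.
  rewrite mulf_neq0 //; first by rewrite subr_eq0 eqr_nat.
  by rewrite pnatr_eq0; lia.
(* the pair itself occurs once or twice in the sum, according to a = b or not *)
pose cl (i : 'I_s.+1) := (i == b :> nat) || (i == a :> nat).
pose k0 : K := \sum_(i | cl i) 1.
have k0n : k0 != 0.
  have lbs : (b < s.+1)%N by rewrite /s; lia.
  rewrite /k0 (bigD1 (Ordinal lbs)) /cl /= ?eqxx // gt_eqF //.
  by apply: ltr_pwDl; [exact: ltr01 | apply: sumr_ge0 => i _; exact: ler01].
pose k := q.[(b * a)%N%:R] * k0.
have kn : k != 0 by rewrite mulf_neq0.
pose far := \sum_(i | ~~ cl i) q.[(i * (s - i))%N%:R] *: (x i * x (s - i)%N).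
have quadE : quad q s = k *: (x a * x b) + far.
  rewrite /quad (bigID cl) /=; congr (_ + _).
  rewrite /k -scalerA /k0 scaler_suml scaler_sumr; apply: eq_bigr => i.
  rewrite scale1r /cl => /orP[] /eqP ->.
    by rewrite /s addnK [x b * _]mulrC.
  by rewrite /s [(a + b)%N]addnC addnK mulnC.
exists (- (k^-1 *: far)); split.
  have -> : x a * x b - - (k^-1 *: far) = k^-1 *: quad q s.
    by rewrite quadE scalerDr scalerA mulVf // scale1r opprK.
  by apply: ideal_scale; apply: quad_ideal.
rewrite -scaleNr; apply: lspanZ; apply: lspan_sum => i ncl.
have lei : (i <= s)%N by rewrite -ltnS.
have [t [le tE]] : exists t, (t <= h)%N /\
    ((i = h - t :> nat /\ s - i = h' + t) \/ (i = h' + t :> nat /\ s - i = h - t))%N.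
  have [le|lt] := leqP i h; first by exists (h - i)%N; split; [lia | left; lia].
  by exists (i - h')%N; split; [lia | right; lia].
have nt : t != t0.
  by apply: contraNneq ncl => tt0; move: tE; rewrite tt0 -bE -aE /cl; lia.
have [lt|ge] := ltnP t m.
  suff -> : q.[(i * (s - i))%N%:R] = 0 by rewrite scale0r; apply: lspan0.
  by case: tE => -[-> ->]; rewrite ?[((h' + t) * _)%N]mulnC q_close.
apply: lspanZ; apply: (lspan_gen _ (t := (nat_of_ord i, (s - i)%N))).
rewrite /Q /=; split; first by rewrite subnKC.
have : ((h - t) ^ 2 + (h' + t) ^ 2 > (h - t0) ^ 2 + (h' + t0) ^ 2)%N.
  have [d dE] : exists d, t = (t0 + d.+1)%N by exists (t - t0).-1; lia.
  have [e eE] : exists e, h = (t + e)%N by exists (h - t)%N; lia.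
  have -> : (h - t = e)%N by lia.
  have -> : (h - t0 = e + d.+1)%N by lia.
  rewrite dE addnA; have : (e < h' + t0)%N by lia.
  by move: (h' + t0)%N => w; clear; rewrite !sqrnD; nia.
by rewrite -aE -bE; case: tE => -[-> ->]; lia.
Qed.

Definition xprod (js : seq nat) : A := \prod_(i <- js) x i.

Lemma not_spread_split N js : sorted geq js -> ~~ spread N js ->
  exists a b js', [/\ perm_eq js (a :: b :: js'), (b <= a)%N & (a < b + N)%N].
Proof.
elim: js => // a [|b js] IHjs //=; rewrite negb_and -ltnNge => /andP[leba sjs].
have [lt _|_ /= nsp] := ltnP a (b + N)%N; first by exists a, b, js.
have [c [d [js' [p le lt]]]] := IHjs sjs nsp.
exists c, d, (a :: js'); split=> //.
apply: (@perm_trans _ [:: a, c, d & js']); first by rewrite perm_cons.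
by rewrite (perm_catCA [:: a] [:: c; d] js').
Qed.

Lemma sumsq_le (js : seq nat) :
  (\sum_(i <- js) i ^ 2 <= (\sum_(i <- js) i) ^ 2)%N.
Proof.
elim: js => [|i js IHjs]; first by rewrite !big_nil.
by rewrite !big_cons sqrnD; lia.
Qed.

(** The relations spread the indices out, at constant sum, until the monomial is
    spread: the sum of the squares increases and stays bounded. *)
Lemma spread_reduction js :
  exists R, I (xprod js - R) /\ lspan xprod (spread (2 * m)) R.
Proof.
have [n] := ubnP ((\sum_(i <- js) i) ^ 2 - \sum_(i <- js) i ^ 2)%N.
elim: n js => // n IHn js ltn.
have psort : perm_eq js (sort geq js) by rewrite perm_sym; apply: permEl; apply: perm_sort.
have [sp|nsp] := boolP (spread (2 * m) (sort geq js)).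
  exists (xprod (sort geq js)); split; last exact: lspan_gen.
  by rewrite /xprod (perm_big _ psort) subrr.
have [|a [b [js' [p le lt]]]] := not_spread_split _ nsp.
  by apply: sort_sorted => i j; rewrite /geq /= leq_total.
have {psort}p := perm_trans psort p.
have [r [Ir Hr]] := close_pair le lt.
have [R [IR HR]] : exists R, I (r * xprod js' - R) /\ lspan xprod (spread (2 * m)) R.
  elim: Hr => [|c t f [Ht1 Ht2] _ [R [IR HR]]].
    by exists 0; rewrite mul0r subrr; split=> //; apply: lspan0.
  have [|R' [IR' HR']] := IHn [:: t.1, t.2 & js'].
    move: ltn; rewrite !(perm_big _ p) /= !big_cons !addnA Ht1.
    have := sumsq_le [:: t.1, t.2 & js']; rewrite !big_cons !addnA Ht1.
    by move: Ht2; lia.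
  exists (c *: R' + R); split; last by apply: lspanD => //; apply: lspanZ.
  have -> : (c *: (x t.1 * x t.2) + f) * xprod js' - (c *: R' + R)
      = c *: (xprod [:: t.1, t.2 & js'] - R') + (f * xprod js' - R).
    by rewrite /xprod !big_cons mulrA mulrDl -scalerAl scalerBr opprD addrACA.
  by apply: ID => //; apply: ideal_scale.
exists R; split=> //.
have -> : xprod js - R = xprod js' * (x a * x b - r) + (r * xprod js' - R).
  rewrite {1}/xprod (perm_big _ p) /= !big_cons mulrBr addrA [xprod js' * r]mulrC subrK.
  by rewrite mulrA [xprod _ * _]mulrC.
by apply: ID => //; apply: IM.
Qed.

End Reduction.

(** * The ideal of relations *)

Section Ideals.
Variables (A : comNzRingType).

Section Closure.
Variables (J : Type) (g : J -> A).

Lemma ideal_gen0 : ideal_gen g 0.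
Proof. by exists [::]; rewrite big_nil. Qed.

Lemma ideal_genD P Q : ideal_gen g P -> ideal_gen g Q -> ideal_gen g (P + Q).
Proof. by move=> [r ->] [r' ->]; exists (r ++ r'); rewrite big_cat. Qed.

Lemma ideal_genM P Q : ideal_gen g Q -> ideal_gen g (P * Q).
Proof.
move=> [r ->]; exists [seq (P * t.1, t.2) | t <- r].
by rewrite big_map mulr_sumr; apply: eq_bigr => t _; rewrite mulrA.
Qed.

Lemma ideal_gen_base j : ideal_gen g (g j).
Proof. by exists [:: (1, j)]; rewrite big_seq1 mul1r. Qed.

End Closure.

Lemma ideal_gen_sub (J J' : Type) (g : J -> A) (g' : J' -> A) P :
  (forall j, ideal_gen g' (g j)) -> ideal_gen g P -> ideal_gen g' P.
Proof.
move=> sub [r ->]; apply: big_rec => [|t f _ If]; first exact: ideal_gen0.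
by apply: ideal_genD => //; apply: ideal_genM.
Qed.

End Ideals.

Section DerivedSeries.
Variables (K : fieldType) (A : comAlgType K) (x : nat -> A).

Lemma iter_fps_deriv i n :
  iter i (@fps_deriv K A) x n = x (n + i)%N *+ (n + i) ^_ i.
Proof.
elim: i n => [|i IHi] n; first by rewrite addn0 ffactn0 mulr1n.
rewrite iterS /fps_deriv IHi addSnnS -mulrnA ffactnSr.
by congr (_ *+ (_ * _)); lia.
Qed.

Definition quad_coef (s i : nat) : A :=
  \sum_(a < s.+1) (a ^_ i * (s - a) ^_ i)%N%:R *: (x a * x (s - a)%N).

(** One of the two falling factorials vanishes. *)
Lemma quad_coef_small s i : (s < i.*2)%N -> quad_coef s i = 0.
Proof.
move=> lt; apply: big1 => a _; have [lta|gea] := ltnP a i.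
  by rewrite ffact_small // scale0r.
by rewrite [(s - a) ^_ i]ffact_small ?muln0 ?scale0r //; lia.
Qed.

Lemma fps_deriv_sqr n i :
  fps_mul (iter i (@fps_deriv K A) x) (iter i (@fps_deriv K A) x) n
    = quad_coef (n + i.*2) i.
Proof.
rewrite /quad_coef (_ : (n + i.*2).+1 = i + (n.+1 + i))%N; last lia.
rewrite big_split_ord /= big1 ?add0r => [|a _]; last by rewrite ffact_small ?scale0r.
rewrite big_split_ord /= [X in _ + X]big1 ?addr0 => [|a _]; last first.
  by rewrite [(_ - _) ^_ i]ffact_small ?muln0 ?scale0r //; have := ltn_ord a; lia.
apply: eq_bigr => k _; rewrite !iter_fps_deriv.
have lek : (k <= n)%N by rewrite -ltnS.
have -> : (n + i.*2 - (i + k) = n - k + i)%N by lia.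
by rewrite [(i + k)%N]addnC mulrnAl mulrnAr -mulrnA scaler_nat mulnC.
Qed.

End DerivedSeries.

Section FockFacts.
Variables (K : numClosedFieldType) (m : nat).
Hypothesis hm : (0 < m)%N.
Local Notation S := (polyN K).
Local Notation sq2m := (sqrtC (2 * m)%N%:R : K).
Local Notation X k := (mon K (ucm (k%N : nat))).

Lemma sig_finite (f : S) : exists L, forall l, (L <= l)%N -> sig m l f = 0.
Proof.
exists (\max_(M <- msupp f) wgt M).+1 => l ltl.
rewrite [f]polyN_sumE linear_sum big_seq big1 // => M Mf.
rewrite linearZ /= sig_mon_eq0 ?scaler0 //; apply: leq_trans ltl.
by rewrite ltnS (@leq_bigmax_seq _ _ xpredT (@wgt)).
Qed.

Lemma fock_vertex_model : vertex_model (2 * m) sq2m (fun k => X k)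
  (@Dh K) (@eZ K m) (@sig K m) (@opX K m).
Proof.
split.
- exact: sqr2m.
- exact: polyN_ind.
- exact: Dh_linear.
- exact: DhM.
- exact: Dh_var.
- exact: eZ_neg.
- exact: eZ0.
- exact: eZ_rec.
- exact: sig_is_linear.
- exact: sigC.
- exact: sig0.
- exact: sig_rec.
- exact: sig_finite.
- exact: opX_is_linear.
- exact: opXE.
Qed.

Local Notation V := fock_vertex_model.

Lemma mode_comm i j (u : fock K) : mode m i (mode m j u) = mode m j (mode m i u).
Proof.
move: u; apply: linear_on_basis => [c u v|c u v|[p M]].
- by rewrite !mode_linear.
- by rewrite !mode_linear.
rewrite -[<< (p, M) >>]/(fvec K p M) -emb_mon.
rewrite !mode_emb; congr (emb _ _).
have e k : - (p + (2 * m)%N%:Z) - k - 1 = (- p - k - 1) - (2 * m)%N%:Z by lia.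
rewrite (e i) (e j).
apply: (op_comm V); rewrite exprM sqrrN !expr1n //.
Qed.

(** The index [p] of the summand reached from [v_(1 - m)] by [j] modes. *)
Definition sector (j : nat) : int := m%:Z - 1 + (2 * m * j)%N%:Z.

Lemma amode_emb k j (f : S) :
  amode m k (emb (sector j) f)
    = emb (sector j.+1) (opX m (k%:Z - (2 * m * j)%N%:Z) f).
Proof.
rewrite /amode mode_emb /sector; congr (emb _ (opX _ _ _)); rewrite ?mulnS; lia.
Qed.

Lemma vac_emb : vac K (1 - m%:Z) = emb (sector 0) 1.
Proof. by rewrite -mon1 emb_mon /vac /sector muln0 addr0 opprB. Qed.

Lemma amode_linear k : linear (@amode K m k).
Proof. exact: mode_linear. Qed.

Lemma amode_comm i j (u : fock K) : amode m i (amode m j u) = amode m j (amode m i u).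
Proof. exact: mode_comm. Qed.

Lemma poly_act_amodeM P Q u :
  poly_act (@amode K m) (P * Q) u = poly_act (@amode K m) P (poly_act (@amode K m) Q u).
Proof. exact: (poly_actM amode_linear amode_comm). Qed.

Lemma xprod_vac js :
  poly_act (@amode K m) (xprod (fun k => X k) js) (vac K (1 - m%:Z))
    = emb (sector (size js)) (vecs (2 * m) (@opX K m) js).
Proof.
elim: js => [|i js IHjs]; first by rewrite /xprod big_nil poly_act1 vac_emb.
by rewrite /xprod big_cons poly_act_amodeM IHjs poly_actX amode_emb.
Qed.

Lemma pair_vac a b :
  poly_act (@amode K m) (X a * X b) (vac K (1 - m%:Z))
    = emb (sector 2) (opX m (a%:Z - (2 * m)%N%:Z) (opX m b%:Z 1)).
Proof.
rewrite poly_act_amodeM (poly_actX _ b) poly_actX vac_emb (amode_emb b).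
by rewrite amode_emb muln0 subr0 muln1.
Qed.

(** The weight of the relation of order [i] is a polynomial of degree [2i < 2m] in
    one of the two indices. *)
Lemma quad_coef_vac s (i : 'I_m) :
  poly_act (@amode K m) (quad_coef (fun k => X k) s i) (vac K (1 - m%:Z)) = 0.
Proof.
pose p : {poly K} := ffact_poly K s i \Po ('X * (s%:R%:P - 'X)).
have sp : (size p <= 2 * m)%N.
  have sz : (size ('X * (s%:R%:P - 'X) : {poly K})%R <= 3)%N.
    apply: leq_trans (size_polyMleq _ _) _.
    have : (size (s%:R%:P - 'X : {poly K})%R <= 2)%N.
      by rewrite -opprB size_polyN size_XsubC.
    by rewrite size_polyX; lia.
  have := size_comp_poly (ffact_poly K s i) ('X * (s%:R%:P - 'X)).
  rewrite -/p size_ffact_poly /= => spE; have lti := ltn_ord i.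
  have le2 : ((size ('X * (s%:R%:P - 'X) : {poly K})%R).-1 <= 2)%N by lia.
  have := leq_mul (leqnn i) le2; rewrite -spE => le.
  by apply: leq_trans (leqSpred _) _; apply: (leq_ltn_trans le); lia.
have pE (a : 'I_s.+1) : (a ^_ i * (s - a) ^_ i)%N%:R = p.[a%:R].
  have lea : (a <= s)%N by rewrite -ltnS.
  by rewrite -ffact_polyE // horner_comp hornerM hornerD hornerN hornerX hornerC
    natrM natrB.
rewrite /quad_coef poly_act_sum.
transitivity (emb (sector 2) (\sum_(a < s.+1) p.[a%:R] *:
    opX m (a%:Z - (2 * m)%N%:Z) (opX m (s%:Z - a%:Z) 1))).
  rewrite linear_sum; apply: eq_bigr => a _.
  have lea : (a <= s)%N by rewrite -ltnS.
  by rewrite poly_actZ pair_vac linearZ pE (subzn lea).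
by rewrite (op_relation fock_vertex_model s sp) linear0.
Qed.

Lemma sector_inj : injective sector.
Proof. by move=> j k; rewrite /sector; nia. Qed.

Definition quads (t : nat * 'I_m) : S := quad_coef (fun k => X k) t.1 t.2.

Lemma xprod_monomial M : exists js, mon K M = xprod (fun k => X k) js.
Proof.
elim/cmonom_ind: M => [|k M [js IHjs]].
  by exists [::]; rewrite /xprod big_nil mon1.
by exists (k :: js); rewrite -monM IHjs /xprod big_cons.
Qed.

Lemma poly_spread_reduction (P : S) : exists R, ideal_gen quads (P - R) /\
  lspan (xprod (fun k => X k)) (spread (2 * m)) R.
Proof.
have IZ c Q : ideal_gen quads Q -> ideal_gen quads (c *: Q).
  by move=> IQ; rewrite -[Q]mul1r scalerAl; apply: ideal_genM.
rewrite [P]polyN_sumE; apply: (big_rec (fun P => exists R, ideal_gen quads (P - R) /\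
  lspan (xprod (fun k => X k)) (spread (2 * m)) R)) => [|M f _ [R [IR HR]]].
  by exists 0; rewrite subrr; split; [exact: ideal_gen0 | exact: lspan0].
have [js ->] := xprod_monomial M.
have [R' [IR' HR']] := @spread_reduction K S m (fun k => X k) (ideal_gen quads)
  (@ideal_gen0 _ _ quads) (@ideal_genD _ _ quads) (@ideal_genM _ _ quads)
  (fun s i => ideal_gen_base quads (s, i)) js.
exists (P@_M *: R' + R); split; last by apply: lspanD => //; apply: lspanZ.
rewrite opprD addrACA -scalerBr; apply: ideal_genD => //; exact: IZ.
Qed.

Lemma quads_vac (P : S) : ideal_gen quads P ->
  poly_act (@amode K m) P (vac K (1 - m%:Z)) = 0.
Proof.
move=> [r ->]; rewrite poly_act_sum big1 // => t _.
rewrite poly_act_amodeM quad_coef_vac.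
exact: (lin0 (poly_act_linear amode_linear _)).
Qed.

(** Reduce [P] to a combination of spread monomials; it still kills the vacuum, so
    the independence of their images makes it zero. *)
Theorem annihilator_quads (P : S) :
  poly_act (@amode K m) P (vac K (1 - m%:Z)) = 0 <-> ideal_gen quads P.
Proof.
split; last exact: quads_vac.
move=> Pv; have [R [IR HR]] := poly_spread_reduction P.
have Rv : poly_act (@amode K m) R (vac K (1 - m%:Z)) = 0.
  have := quads_vac IR; rewrite poly_actD -scaleN1r poly_actZ Pv add0r scaleN1r.
  by move=> /eqP; rewrite oppr_eq0 => /eqP.
suff R0 : R = 0 by move: IR; rewrite R0 subr0.
have [r [d [ur sr RE]]] := lspan_uniq HR.
rewrite RE big_seq big1 // => js jsr.
suff -> : d js = 0 by rewrite scale0r.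
have c0 : sq2m != 0 by rewrite sqrtC_eq0 pnatr_eq0; lia.
apply: (vecs_free fock_vertex_model c0 ur sr _ jsr) => k.
apply/malgP => M; rewrite mcoeff0.
have := congr1 (fun u : fock K => u@_(sector k, M)) Rv.
rewrite mcoeff0 RE poly_act_sum raddf_sum /= => <-.
rewrite raddf_sum big_mkcond; apply: eq_bigr => js' _ /=.
rewrite poly_actZ xprod_vac !mcoeffZ mcoeff_emb (inj_eq sector_inj).
by case: eqP; rewrite ?mulr0.
Qed.

End FockFacts.

Section Relations.
Variables (K : numClosedFieldType) (m : nat).

Lemma quad_coef_ext (A : comAlgType K) (x y : nat -> A) s i :
  x =1 y -> quad_coef x s i = quad_coef y s i.
Proof.
by move=> xy; apply: eq_bigr => a _; rewrite (xy a) (xy (s - a)%N).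
Qed.

Lemma quad_relE (t : nat * 'I_m) : quad_rel K t = quads K t.
Proof. exact: (quad_coef_ext _ _ (@varNE K)). Qed.

(** Differentiating shifts the indices: the coefficient of [z^s] comes from pairs
    of indices with sum [s + 2i]. *)
Lemma phi_relE (t : nat * 'I_m) :
  phi_rel K t = quads K ((t.1 + t.2.*2)%N, t.2).
Proof.
rewrite -[RHS](quad_coef_ext _ _ (@varNE K)).
exact: (fps_deriv_sqr (@phi_plus K)).
Qed.

Lemma ideal_quad_rel (P : polyN K) :
  ideal_gen (@quad_rel K m) P <-> ideal_gen (@quads K m) P.
Proof.
split; apply: ideal_gen_sub => t; first by rewrite quad_relE; apply: ideal_gen_base.
by rewrite -quad_relE; apply: ideal_gen_base.
Qed.

Lemma ideal_phi_rel (P : polyN K) :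
  ideal_gen (@phi_rel K m) P <-> ideal_gen (@quads K m) P.
Proof.
split; apply: ideal_gen_sub => -[s i].
  by rewrite phi_relE; apply: ideal_gen_base.
have [lt|ge] := ltnP s i.*2.
  by rewrite /quads quad_coef_small //; apply: ideal_gen0.
have -> : quads K (s, i) = phi_rel K ((s - i.*2)%N, i).
  by rewrite phi_relE /= subnK.
exact: ideal_gen_base.
Qed.

End Relations.

Theorem lemma2p1 (R : realType) (m : nat) (hm : (1 <= m)%N) :
  iso_quotient (@amode R[i] m) (@Vm R[i] m) (ideal_gen (@phi_rel R[i] m)) /\
  (forall P : polyN R[i],
     poly_act (@amode R[i] m) P (vac R[i] (1 - m%:Z)) = 0 <->
     ideal_gen (@quad_rel R[i] m) P).
Proof.
pose v := vac R[i] (1 - m%:Z).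
split; last first.
  by move=> P; apply: iff_trans (annihilator_quads hm P) (iff_sym (ideal_quad_rel m P)).
pose f := HB.pack_for {linear polyN R[i] -> fock R[i]}
  (fun P : polyN R[i] => poly_act (@amode R[i] m) P v)
  (GRing.isLinear.Build _ _ _ _ _ (poly_act_is_linear (@amode R[i] m) v)).
exists f; split.
- by move=> P Q; apply: poly_act_amodeM.
- by move=> w; split=> -[P eqP]; exists P.
- by move=> P; apply: iff_trans (annihilator_quads hm P) (iff_sym (ideal_phi_rel m P)).
Qed.
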